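(* Let $D\subset\mathbf{R}^n$ be a bounded open region. Let $1<p<n$, $\frac np<r\le\infty$, and let $q$ satisfy $\frac1r+\frac pq=1$. Let $V\in L^r(D)$, let $E\le0$ be a constant, and let $u\in W_0^{1,p}(D)$ be a nontrivial solution of $$-\Delta_p u-V|u|^{p-2}u=E|u|^{p-2}u .$$ Then $K_{q,p}^p\,\|(V+E)_+\|_r\ge1$.
   Context: $D$ is a bounded open region in $\mathbf{R}^n$; nothing is assumed about its boundary. $\Delta_p u=\mathrm{div}(|\nabla u|^{p-2}\nabla u)$. $V$ is real-valued, $u$ may be complex-valued, and $f_+=\max(f,0)$. The equation is understood in the distribution sense: $\int_D|\nabla u|^{p-2}\nabla u\cdot\nabla\psi\,dx=\int_D (V+E)|u|^{p-2}u\,\psi\,dx$ for all $\psi\in C_0^\infty(D)$ (with $|u|^{p-2}u$ read as $0$ where $u=0$, and likewise for the gradient). The Sobolev constant is $K_{q,p}=\sup_{0\ne u\in W_0^{1,p}(D)}\|u\|_q/\|\nabla u\|_p$, norms being taken over $D$. *)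

(* Defs.v *)
From HB Require Import structures.
From mathcomp Require Import all_boot all_order all_algebra.
From mathcomp Require Import all_classical all_reals all_analysis.
From mathcomp Require Import complex.
Set Implicit Arguments.
Unset Strict Implicit.
Unset Printing Implicit Defensive.
Import Order.TTheory GRing.Theory Num.Theory.
Import numFieldNormedType.Exports.
Local Open Scope classical_set_scope.
Local Open Scope ring_scope.

(* Row vectors carry the sigma-algebra generated by the coordinates, as the
   library does for tuples; it is the Borel sigma-algebra of R^n. *)
Section measurable_rV.
Context {R : realType} (n : nat).

Let coord (i : 'I_n) (x : 'rV[R]_n) : measurableTypeR R := x ord0 i.

Let rV_set0 : g_sigma_preimage coord set0.
Proof. exact: sigma_algebra0. Qed.

Let rV_setC A : g_sigma_preimage coord A -> g_sigma_preimage coord (~` A).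
Proof. exact: sigma_algebraC. Qed.

Let rV_bigcup (F : _^nat) : (forall i, g_sigma_preimage coord (F i)) ->
  g_sigma_preimage coord (\bigcup_i (F i)).
Proof. exact: sigma_algebra_bigcup. Qed.

HB.instance Definition _ := @isMeasurable.Build default_measure_display
  'rV[R]_n (g_sigma_preimage coord) rV_set0 rV_setC rV_bigcup.

Lemma measurable_coord (i : 'I_n) :
  measurable_fun [set: 'rV[R]_n] (fun x : 'rV[R]_n => x ord0 i).
Proof.
move=> _ Y mY; rewrite setTI; apply: sub_sigma_algebra => /=.
rewrite -bigcup_seq/=; exists i => /=; first by rewrite mem_index_enum.
by exists Y => //; rewrite setTI.
Qed.

Lemma measurable_fun_rV d (T : measurableType d) (f : T -> 'rV[R]_n) :
  (forall i, measurable_fun [set: T] (fun x => f x ord0 i)) ->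
  measurable_fun [set: T] f.
Proof.
move=> mf _ A mA; rewrite setTI.
suff : g_sigma_preimage (fun i => coord i \o f) `<=` measurable.
  apply; rewrite g_sigma_preimage_comp.
  by exists A => //; rewrite setTI.
apply: smallest_sub; first exact: sigma_algebra_measurable.
rewrite -bigcup_seq; apply: bigcup_sub => i _ B [C mC <-].
exact: mf.
Qed.

End measurable_rV.

Section lebesgue_rV.
Context {R : realType}.

Definition rV_cons n (p : measurableTypeR R * 'rV[R]_n) : 'rV[R]_n.+1 :=
  row_mx (const_mx p.1 : 'rV[R]_1) p.2.

Lemma measurable_rV_cons n : measurable_fun setT (@rV_cons n).
Proof.
apply: measurable_fun_rV => i; rewrite /rV_cons.
case: (@splitP 1 n i) => j ij.
- rewrite (_ : (fun x => _) = fst); first exact: measurable_fst.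
  apply/funext => x; rewrite (_ : i = lshift n j); last exact/val_inj.
  by rewrite [LHS](row_mxEl _ _ ord0 j) mxE.
- rewrite (_ : (fun x => _) = (fun v : 'rV[R]_n => v ord0 j) \o snd).
    by apply: measurableT_comp; [exact: measurable_coord|exact: measurable_snd].
  apply/funext => x; rewrite (_ : i = rshift 1 j); last exact/val_inj.
  by rewrite [LHS](row_mxEr _ _ ord0 j).
Qed.

Section step.
Context (n : nat) (mu : {sigma_finite_measure set 'rV[R]_n -> \bar R}).

Let prod_mu : {measure set (measurableTypeR R * 'rV[R]_n)%type -> \bar R} :=
  (@lebesgue_measure R \x mu)%E.

Definition lebesgue_step : set 'rV[R]_n.+1 -> \bar R :=
  pushforward prod_mu (@rV_cons n).

Let step0 : lebesgue_step set0 = 0%E.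
Proof. by rewrite /lebesgue_step /pushforward preimage_set0 measure0. Qed.

Let step_ge0 A : (0 <= lebesgue_step A)%E.
Proof. exact: (measure_ge0 prod_mu). Qed.

Let step_sigma_additive : semi_sigma_additive lebesgue_step.
Proof.
pose nu : {measure set _ -> \bar R} :=
  measure_function_pushforward__canonical__measure_function_Measure prod_mu
  (@measurable_rV_cons n).
exact: (@measure_semi_sigma_additive _ _ _ nu).
Qed.

HB.instance Definition _ := isMeasure.Build _ _ _ lebesgue_step
  step0 step_ge0 step_sigma_additive.

Let step_sigma_finite : sigma_finite setT lebesgue_step.
Proof.
have /sigma_finiteP[F [TF ndF mF]] := sigma_finiteT (@lebesgue_measure R).
have /sigma_finiteP[G [TG ndG mG]] := sigma_finiteT mu.
pose h (v : 'rV[R]_n.+1) : measurableTypeR R * 'rV[R]_n :=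
  (v ord0 (lshift n (ord0 : 'I_1)), \row_j v ord0 (rshift 1 j)).
have hK : cancel (@rV_cons n) h.
  move=> [x v]; rewrite /h /rV_cons; congr pair => /=.
    by rewrite [LHS](row_mxEl _ _ ord0 ord0) mxE.
  by apply/rowP => j; rewrite mxE [LHS](row_mxEr _ _ ord0 j).
have mh : measurable_fun setT h.
  apply/measurable_fun_pairP; split; first exact: measurable_coord.
  apply: measurable_fun_rV => j.
  rewrite (_ : (fun x => _) = (fun v : 'rV[R]_n.+1 => v ord0 (rshift 1 j))).
    exact: measurable_coord.
  by apply/funext => x /=; rewrite mxE.
exists (fun k => h @^-1` (F k `*` G k)) => [|k].
  apply/esym; rewrite -subTset => v _.
  have [i _ Fi] : (\bigcup_i F i) (h v).1 by rewrite -TF.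
  have [j _ Gj] : (\bigcup_i G i) (h v).2 by rewrite -TG.
  exists (maxn i j) => //; split.
    by move: Fi; exact/subsetPset/ndF/leq_maxl.
  by move: Gj; exact/subsetPset/ndG/leq_maxr.
have [mFk Fkoo] := mF k; have [mGk Gkoo] := mG k; split.
  rewrite -[X in measurable X]setTI; apply: mh => //.
  exact: measurableX.
rewrite /lebesgue_step /pushforward -comp_preimage.
rewrite (_ : h \o _ = idfun) ?preimage_id; last first.
  by apply/funext => x; exact: hK.
rewrite [ltLHS](product_measure1E (@lebesgue_measure R) mu mFk mGk).
by rewrite lte_mul_pinfty// ge0_fin_numE.
Qed.

HB.instance Definition _ :=
  Measure_isSigmaFinite.Build _ _ _ lebesgue_step step_sigma_finite.

End step.

Fixpoint lebesgue_rV n : {sigma_finite_measure set 'rV[R]_n -> \bar R} :=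
  match n with
  | 0 => \d_(0 : 'rV[R]_0)
  | m.+1 => lebesgue_step (lebesgue_rV m)
  end.

End lebesgue_rV.

Section sobolev.
Context {R : realType} {n : nat}.
Local Notation mu := (@lebesgue_rV R n).
Implicit Types (D : set 'rV[R]_n) (p q : R).
Implicit Types (u phi : 'rV[R]_n -> R[i]) (g : 'rV[R]_n -> 'rV[R[i]]_n).

Definition modulus (z : R[i]) : R := ComplexField.Normc.normc z.

Definition vec_modulus (v : 'rV[R[i]]_n) : R :=
  Num.sqrt (\sum_(i < n) modulus (v ord0 i) ^+ 2).

(* The bilinear product, without conjugation. *)
Definition dotc (v w : 'rV[R[i]]_n) : R[i] :=
  \sum_(i < n) v ord0 i * w ord0 i.

(* Only the values of [f] on [D] matter below: [f \_ D] is [f] extended by 0. *)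
Definition Lnorm_on D (r : \bar R) (f : 'rV[R]_n -> R) : \bar R :=
  Lnorm mu r (EFin \o (f \_ D)).

Definition in_Lp D (r : \bar R) (f : 'rV[R]_n -> R) : Prop :=
  measurable_fun [set: 'rV[R]_n] (f \_ D) /\ (Lnorm_on D r f < +oo)%E.

Definition in_Lpc D p u : Prop :=
  in_Lp D p%:E (fun x => complex.Re (u x)) /\
  in_Lp D p%:E (fun x => complex.Im (u x)).

Definition Cintegral D (f : 'rV[R]_n -> R[i]) : R[i] :=
  Complex (\int[mu]_(x in D) complex.Re (f x))
          (\int[mu]_(x in D) complex.Im (f x)).

Definition partial (i : 'I_n) (f : 'rV[R]_n -> R) : 'rV[R]_n -> R :=
  fun x => 'D_(delta_mx ord0 i) f x.

(* All iterated partial derivatives exist and are continuous. *)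
Definition smooth (f : 'rV[R]_n -> R) : Prop :=
  forall s : seq 'I_n, let h := foldr partial f s in
    continuous h /\ forall i x, derivable h x (delta_mx ord0 i).

Definition Cc_infty D phi : Prop :=
  [/\ smooth (fun x => complex.Re (phi x)),
      smooth (fun x => complex.Im (phi x)),
      compact (closure [set x | phi x != 0]) &
      closure [set x | phi x != 0] `<=` D].

Definition grad phi : 'rV[R]_n -> 'rV[R[i]]_n := fun x =>
  \row_i Complex (partial i (fun y => complex.Re (phi y)) x)
                 (partial i (fun y => complex.Im (phi y)) x).

Definition weak_gradient D u g : Prop :=
  forall phi, Cc_infty D phi -> forall i : 'I_n,
    Cintegral D (fun x => u x * grad phi x ord0 i) =
    - Cintegral D (fun x => g x ord0 i * phi x).

(* [W1p D p u g]: [u] belongs to W^{1,p}(D) and [g] is its weak gradient. *)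
Definition W1p D p u g : Prop :=
  [/\ in_Lpc D p u, forall i : 'I_n, in_Lpc D p (fun x => g x ord0 i) &
      weak_gradient D u g].

Definition norm_W1p D p u g : \bar R :=
  (Lnorm_on D p%:E (modulus \o u) + Lnorm_on D p%:E (vec_modulus \o g))%E.

(* W_0^{1,p}(D) is the closure of C_c^oo(D) in W^{1,p}(D). *)
Definition W01p D p u g : Prop :=
  W1p D p u g /\
  exists2 phi : nat -> 'rV[R]_n -> R[i], forall k, Cc_infty D (phi k) &
    norm_W1p D p (fun x => u x - phi k x) (fun x => g x - grad (phi k) x)
      @[k --> \oo] --> 0%E.

Definition nontrivial_on D u : Prop :=
  ~ {ae mu, forall x, D x -> u x = 0}.

Definition sobolev_constant D q p : \bar R :=
  ereal_sup [set c | exists u g, [/\ W01p D p u g, nontrivial_on D u &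
    c = (Lnorm_on D q%:E (modulus \o u) /
         Lnorm_on D p%:E (vec_modulus \o g))%E]].

(* -Delta_p u - V |u|^{p-2} u = E |u|^{p-2} u in the distribution sense, where
   [g] is the weak gradient of [u].  The products below vanish where [u],
   respectively [g], vanishes. *)
Definition weak_solution D p (V : 'rV[R]_n -> R) (E : R) u g : Prop :=
  forall psi, Cc_infty D psi ->
    Cintegral D (fun x =>
      (vec_modulus (g x) `^ (p - 2))%:C%C * dotc (g x) (grad psi x)) =
    Cintegral D (fun x =>
      ((V x + E) * modulus (u x) `^ (p - 2))%:C%C * u x * psi x).

End sobolev.

(* Main.v *)
Require Import Defs.
From mathcomp Require Import all_boot all_order all_algebra.
From mathcomp Require Import all_classical all_reals all_analysis.
From mathcomp Require Import measurable_realfun ess_sup_inf.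
From mathcomp Require Import complex ring lra.

(* Testing the equation with the conjugates of smooth functions converging to u
   gives, in the limit, \int |Du|^p = \int (V + E) |u|^p, and Hoelder's inequality
   bounds the right-hand side by ||(V + E)_+||_r ||u||_q^p. Since u itself is
   admissible in the supremum defining K_{q,p}, the ratio ||u||_q / ||Du||_p is
   at most K_{q,p}.

   The passage to the limit and the positivity of ||Du||_p require the embedding
   of W_0^{1,p} into L^q. For C^1 functions it follows from the inequality
   ||f||_{n/(n-1)} <= \sum_i ||d_i f||_1, proved by induction on n by slicing,
   applied to a power of |f|. It extends to the closure by truncation, and q lies
   between p and the critical exponent np/(n-p) because r > n/p. *)

Set Implicit Arguments.
Unset Strict Implicit.
Unset Printing Implicit Defensive.
Import Order.TTheory GRing.Theory Num.Theory.
Import numFieldNormedType.Exports.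
Local Open Scope classical_set_scope.
Local Open Scope ring_scope.

(** * Hoelder's inequality *)

(** The equation may only be tested with smooth functions, so its nonlinear factors are frozen at u
    and only the test function moves. Frozen, they are fixed weights. By Hoelder |Du|^(p-2) Du pairs
    with L^p, but (V + E) |u|^(p-2) u pairs only with L^q, because 1/r + (p-1)/q + 1/q = 1. When q >
    p, convergence in W^{1,p} does not by itself give convergence in L^q; this is the obstacle that
    calls for the embedding. Its constant may be crude: it serves finiteness, convergence and the
    exclusion of Du = 0, and never enters the value of K_{q,p}.

    The boundary of D is arbitrary, so functions of W_0^{1,p} are reached only as limits of test
    functions. These vanish outside D and live on all of R^n, where slicing is possible. Real and
    imaginary parts are approximated separately, which leaves only real-valued analysis. *)

Section powers.
Context {R : realType}.
Local Open Scope ereal_scope.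

Lemma measurable_poweRT d (T : measurableType d) (f : T -> \bar R) (t : R) :
  measurable_fun [set: T] f -> measurable_fun [set: T] (fun x => f x `^ t).
Proof.
move=> mf; apply: (@measurableT_comp _ _ _ _ _ _ (fun x => x `^ t)) => //=.
exact: measurable_poweR.
Qed.

Lemma ge0_le_poweR (x y : \bar R) (t : R) : (0 <= t)%R ->
  0 <= x -> x <= y -> x `^ t <= y `^ t.
Proof.
move=> t0 x0 xy; apply: gt0_ler_poweR => //.
- by rewrite in_itv/= x0 leey.
- by rewrite in_itv/= (le_trans x0 xy) leey.
Qed.

Lemma measurable_abs_powR d (T : measurableType d) (D : set T) (h : T -> R)
    (t : R) : measurable_fun D h ->
  measurable_fun D (fun x => (`|h x| `^ t)%:E).
Proof.
move=> mh; apply/measurable_EFinP.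
apply: (@measurableT_comp _ _ _ _ _ _ (fun x => x `^ t)%R).
  exact: measurable_powR.
exact: measurableT_comp.
Qed.

End powers.

Section hoelder_weights.
Context d {T : measurableType d} {R : realType}.
Variable mu : {measure set T -> \bar R}.
Local Open Scope ereal_scope.
Implicit Types (f g : T -> \bar R) (t : R).

(** The degenerate case: if the integral of g is infinite, the right side of the weighted inequality
    is 0 times +oo, that is 0, so the left side must be shown to vanish. *)
Let integral0_poweR f g t : (0 < t < 1)%R ->
  measurable_fun [set: T] f -> measurable_fun [set: T] g ->
  (forall x, 0 <= f x) -> (forall x, 0 <= g x) ->
  \int[mu]_x f x = 0 -> \int[mu]_x (f x `^ t * g x `^ (1 - t)) = 0.
Proof.
move=> /andP[t0 t1] mf mg f0 g0 If.
have : {ae mu, forall x, f x = 0}.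
  have := @ae_eq_integral_abs _ _ _ mu _ measurableT _ mf.
  rewrite (eq_integral f); last by move=> x _; rewrite gee0_abs.
  by move=> [/(_ If) + _]; apply: filterS => x /= ->.
move=> f_ae0; rewrite (@ae_eq_integral _ _ _ mu setT (cst 0)) ?integral0//.
  apply: emeasurable_funM; exact: measurable_poweRT.
by apply: filterS f_ae0 => x /= -> _; rewrite poweR0r ?gt_eqF// mul0e.
Qed.

(** Hoelder for f^t and g^(1-t) with exponents 1/t and 1/(1-t). Extended values are allowed because
    the weights of the slicing argument are themselves integrals. *)
Lemma hoelder_weights f g t : (0 < t < 1)%R ->
  measurable_fun [set: T] f -> measurable_fun [set: T] g ->
  (forall x, 0 <= f x) -> (forall x, 0 <= g x) ->
  \int[mu]_x (f x `^ t * g x `^ (1 - t)) <=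
  (\int[mu]_x f x) `^ t * (\int[mu]_x g x) `^ (1 - t).
Proof.
move=> t01 mf mg f0 g0; have /andP[t0 t1] := t01.
have s0 : (0 < 1 - t)%R by rewrite subr_gt0.
have t01' : (0 < 1 - t < 1)%R by rewrite s0 gtrBl.
have If0 : 0 <= \int[mu]_x f x by exact: integral_ge0.
have Ig0 : 0 <= \int[mu]_x g x by exact: integral_ge0.
have [fz|fnz] := eqVneq (\int[mu]_x f x) 0.
  by rewrite integral0_poweR// mule_ge0 ?poweR_ge0.
have [gz|gnz] := eqVneq (\int[mu]_x g x) 0.
  rewrite [leLHS](_ : _ = 0) ?mule_ge0 ?poweR_ge0//.
  rewrite -[RHS](integral0_poweR t01' mg mf g0 f0 gz).
  by apply: eq_integral => x _; rewrite subKr muleC.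
have [foo|ffin] := eqVneq (\int[mu]_x f x) +oo.
  by rewrite foo poweRyr ?gt_eqF// gt0_mulye ?leey// poweR_gt0// lt0e gnz.
have [goo|gfin] := eqVneq (\int[mu]_x g x) +oo.
  by rewrite goo poweRyr ?gt_eqF// gt0_muley ?leey// poweR_gt0// lt0e fnz.
(* Once both integrals are finite, the functions are finite almost everywhere and can be replaced by
   their real values [a] and [b]. *)
have fini h : measurable_fun setT h -> (forall x, 0 <= h x) ->
    \int[mu]_x h x != +oo -> {ae mu, forall x, h x = (fine (h x))%:E}.
  move=> mh h0 hfin; have ih : mu.-integrable setT h.
    apply/integrableP; split => //.
    by under eq_integral do rewrite gee0_abs//; rewrite ltey.
  have := integrable_ae measurableT ih; apply: filterS => x /= /(_ I) hx.
  by rewrite fineK.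
have faE := fini _ mf f0 ffin; have gaE := fini _ mg g0 gfin.
pose a x := fine (f x); pose b x := fine (g x).
have ma : measurable_fun setT a by exact: measurableT_comp.
have mb : measurable_fun setT b by exact: measurableT_comp.
have mat : measurable_fun setT (fun x => a x `^ t)%R.
  exact: (measurableT_comp (measurable_powR _)).
have mbs : measurable_fun setT (fun x => b x `^ (1 - t))%R.
  exact: (measurableT_comp (measurable_powR _)).
have := hoelder mu mat mbs (p := t^-1) (q := (1 - t)^-1).
rewrite !invr_gt0 !invrK => /(_ t0 s0 (subrKC _ _)).
rewrite Lnorm1 [X in X <= _](_ : _ = \int[mu]_x (f x `^ t * g x `^ (1 - t))); last first.
  apply: ae_eq_integral => //.
  - apply: measurableT_comp => //; apply/measurable_EFinP.
    exact: measurable_funM.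
  - by apply: emeasurable_funM; exact: measurable_poweRT.
  - apply: filterS2 faE gaE => x fE gE _ /=.
    by rewrite fE gE /= ger0_norm ?EFinM// mulr_ge0 ?powR_ge0.
have LE h (c : R) : (0 < c)%R -> measurable_fun setT h -> (forall x, 0 <= h x) ->
    {ae mu, forall x, h x = (fine (h x))%:E} ->
    'N[mu]_(c^-1)%:E[EFin \o (fun x => fine (h x) `^ c)%R] = (\int[mu]_x h x) `^ c.
  move=> c0 mh h0 hE; rewrite unlock invrK; congr (_ `^ _).
  apply: ae_eq_integral => //.
  - apply: measurable_poweRT; apply: measurableT_comp => //.
    apply/measurable_EFinP/(measurableT_comp (measurable_powR _)).
    exact: measurableT_comp.
  - apply: filterS hE => x hE _ /=.
    rewrite ger0_norm ?powR_ge0// -powRrM mulfV ?gt_eqF// powRr1 -?hE//.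
    by rewrite fine_ge0.
by rewrite !LE.
Qed.

Lemma hoelder_weights_on (D : set T) f g t : measurable D -> (0 < t < 1)%R ->
  measurable_fun D f -> measurable_fun D g ->
  (forall x, D x -> 0 <= f x) -> (forall x, D x -> 0 <= g x) ->
  \int[mu]_(x in D) (f x `^ t * g x `^ (1 - t)) <=
  (\int[mu]_(x in D) f x) `^ t * (\int[mu]_(x in D) g x) `^ (1 - t).
Proof.
move=> mD t01 mf mg f0 g0; have /andP[t0 t1] := t01.
rewrite integral_mkcond (integral_mkcond D f) (integral_mkcond D g).
rewrite (_ : _ \_ D = fun x => (f \_ D) x `^ t * (g \_ D) x `^ (1 - t)).
  apply: hoelder_weights => //.
  - exact/(measurable_restrictT _ mD).1.
  - exact/(measurable_restrictT _ mD).1.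
  - by move=> x; apply: erestrict_ge0.
  - by move=> x; apply: erestrict_ge0.
apply/funext => x; rewrite !patchE; case: ifPn => // _.
by rewrite poweR0r ?gt_eqF// mul0e.
Qed.

End hoelder_weights.

(** * The Borel sigma-algebra and the Lebesgue measure of R^n *)

Section borel_rV.
Context {R : realType} {n : nat}.

Definition open_box (a b : 'rV[R]_n) : set 'rV[R]_n :=
  [set x | forall i, a ord0 i < x ord0 i < b ord0 i].

Lemma measurable_open_box a b : measurable (open_box a b).
Proof.
rewrite (_ : open_box a b =
    \bigcap_(i in [set: 'I_n])
      ((fun x : 'rV[R]_n => x ord0 i) @^-1` `]a ord0 i, b ord0 i[%classic)).
  apply: fin_bigcap_measurable => // i _.
  rewrite -[X in measurable X]setTI; exact: measurable_coord.
apply/seteqP; split => x /= xab i; first by move=> _; rewrite /= in_itv/= xab.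
by have := xab i I; rewrite /= in_itv.
Qed.

(** Ties the sigma-algebra generated by the coordinates to the topology: an open set is the union of
    the countably many boxes with rational corners that it contains. *)
Lemma open_measurable_rV (U : set 'rV[R]_n) : open U -> measurable U.
Proof.
have cntb : countable [set: 'rV[rat]_n * 'rV[rat]_n] by exact: countableP.
move=> oU; pose rV (c : 'rV[rat]_n) : 'rV[R]_n := map_mx ratr c.
pose F (c : 'rV[rat]_n * 'rV[rat]_n) :=
  if pselect (open_box (rV c.1) (rV c.2) `<=` U)
  then open_box (rV c.1) (rV c.2) else set0.
rewrite (_ : U = \bigcup_c F c).
  have mF c : measurable (F c).
    rewrite /F; case: pselect => ?; first exact: measurable_open_box.
    exact: measurable0.
  exact: (countable_bigcupT_measurable cntb mF).
apply/seteqP; split => [x Ux|x [c _]]; last first.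
  by rewrite /F; case: pselect => // h /h.
have /nbhs_ballP[e /= e0 xeU] := open_nbhs_nbhs (conj oU Ux).
have ratl (i : 'I_n) : {q : rat | x ord0 i - e < ratr q < x ord0 i}.
  apply/cid; have [|q] := @rat_in_itvoo R (x ord0 i - e) (x ord0 i).
    by rewrite gtrBl.
  by rewrite in_itv/=; exists q.
have ratr' (i : 'I_n) : {q : rat | x ord0 i < ratr q < x ord0 i + e}.
  apply/cid; have [|q] := @rat_in_itvoo R (x ord0 i) (x ord0 i + e).
    by rewrite ltrDl.
  by rewrite in_itv/=; exists q.
exists (\row_i sval (ratl i), \row_i sval (ratr' i)) => //.
rewrite /F; case: pselect => /=.
  move=> _ i; rewrite !mxE.
  by have /andP[_ ->] := svalP (ratl i); have /andP[-> _] := svalP (ratr' i).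
case => y yab; apply: xeU; split => // i j; rewrite (ord1 i).
have := yab j; rewrite !mxE => /andP[y1 y2].
have /andP[a1 a2] := svalP (ratl j); have /andP[b1 b2] := svalP (ratr' j).
rewrite /ball/= ltr_norml; apply/andP; split; lra.
Qed.

Lemma continuous_measurable_rV (f : 'rV[R]_n -> R) :
  continuous f -> measurable_fun [set: 'rV[R]_n] f.
Proof.
move=> cf; apply: (measurability _ (RGenOpens.measurableE R)).
move=> _ [_ [a [b ->] <-]]; rewrite setTI; apply: open_measurable_rV.
by apply: open_comp => // x _; exact: cf.
Qed.

End borel_rV.

Section slicing.
Context {R : realType}.
Local Open Scope ereal_scope.

Definition set_coord n (i : 'I_n) (x : 'rV[R]_n) (t : R) : 'rV[R]_n :=
  \row_j if j == i then t else x ord0 j.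

Lemma rV_cons0 n (p : measurableTypeR R * 'rV[R]_n) :
  rV_cons p ord0 ord0 = p.1.
Proof.
rewrite (_ : ord0 = lshift n ord0 :> 'I_(1 + n)); last exact/val_inj.
by rewrite [LHS](row_mxEl _ _ ord0) mxE.
Qed.

Lemma rV_consS n (p : measurableTypeR R * 'rV[R]_n) (j : 'I_n) :
  rV_cons p ord0 (lift ord0 j) = p.2 ord0 j.
Proof.
rewrite (_ : lift ord0 j = rshift 1 j :> 'I_(1 + n)); last exact/val_inj.
by rewrite [LHS](row_mxEr _ _ ord0).
Qed.

Lemma set_coord_cons0 n (s t : R) (y : 'rV[R]_n) :
  set_coord ord0 (rV_cons (s, y)) t = rV_cons (t, y).
Proof.
apply/rowP => j; rewrite [LHS]mxE; case: (unliftP ord0 j) => [k ->|->].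
  by rewrite -(inj_eq val_inj)/= !rV_consS.
by rewrite eqxx rV_cons0.
Qed.

Lemma set_coord_consS n (s t : R) (y : 'rV[R]_n) (i : 'I_n) :
  set_coord (lift ord0 i) (rV_cons (s, y)) t = rV_cons (s, set_coord i y t).
Proof.
apply/rowP => j; rewrite [LHS]mxE; case: (unliftP ord0 j) => [k ->|->].
  by rewrite !rV_consS (inj_eq lift_inj) mxE; case: ifP.
by rewrite (negbTE (neq_lift _ _)) !rV_cons0.
Qed.

Lemma measurable_rV_cons_slice n (t : measurableTypeR R) :
  measurable_fun [set: 'rV[R]_n] (fun y => rV_cons (t, y)).
Proof.
apply: (measurableT_comp (@measurable_rV_cons R n)); exact: measurable_pair1.
Qed.

Section integrals.
Context (n : nat) (f : 'rV[R]_n.+1 -> \bar R).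
Hypothesis mf : measurable_fun [set: 'rV[R]_n.+1] f.
Hypothesis f0 : forall x, 0 <= f x.

Let mfc : measurable_fun [set: measurableTypeR R * 'rV[R]_n]
  (fun p => f (rV_cons p)).
Proof. exact: (measurableT_comp mf (@measurable_rV_cons R n)). Qed.

Let mu := (@lebesgue_measure R).
Let nu := (@lebesgue_rV R n).

(** By construction the measure in dimension n + 1 is the image of a product measure under
    [rV_cons], so Tonelli's theorem gives both orders of integration. *)
Let push : \int[lebesgue_rV n.+1]_x f x = \int[mu \x nu]_p f (rV_cons p).
Proof.
have := @ge0_integral_pushforward _ _ _ _ R (@rV_cons R n)
  (@measurable_rV_cons R n) (mu \x nu) setT f measurableT mf.
by rewrite preimage_setT; apply.
Qed.

Lemma integral_rV_cons :
  \int[lebesgue_rV n.+1]_x f x =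
  \int[lebesgue_measure]_t \int[lebesgue_rV n]_y f (rV_cons (t, y)).
Proof. by rewrite push (fubini_tonelli1 (fun p => f (rV_cons p))). Qed.

Lemma integral_rV_cons_swap :
  \int[lebesgue_rV n.+1]_x f x =
  \int[lebesgue_rV n]_y \int[lebesgue_measure]_t f (rV_cons (t, y)).
Proof. by rewrite push (fubini_tonelli2 (fun p => f (rV_cons p))). Qed.

Lemma measurable_integral_rV_cons :
  measurable_fun [set: measurableTypeR R]
    (fun t => \int[lebesgue_rV n]_y f (rV_cons (t, y))).
Proof. exact: (measurable_fun_fubini_tonelli_F (fun p => f (rV_cons p))). Qed.

Lemma measurable_integral_rV_cons_swap :
  measurable_fun [set: 'rV[R]_n]
    (fun y => \int[lebesgue_measure]_t f (rV_cons (t, y))).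
Proof. exact: (measurable_fun_fubini_tonelli_G (fun p => f (rV_cons p))). Qed.

End integrals.

Lemma lebesgue_rV_open_box n (M : R) :
  (lebesgue_rV n (open_box (const_mx (- M)%R) (const_mx M)) < +oo)%E.
Proof.
elim: n => [|n IHn].
  by rewrite /= /dirac/= ltry.
rewrite /= /lebesgue_step /pushforward.
rewrite (_ : _ @^-1` _ = `](- M)%R, M[%classic `*`
    open_box (const_mx (- M)%R) (const_mx M)); last first.
  apply/seteqP; split => [[t y]/= ty|[t y]/= [tM yM] i].
    split => [|i]; first by have := ty ord0; rewrite rV_cons0 !mxE in_itv.
    by have := ty (lift ord0 i); rewrite rV_consS !mxE.
  case: (unliftP ord0 i) => [k ->|->]; rewrite ?rV_consS ?rV_cons0 !mxE//=.
  by have := yM k; rewrite !mxE.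
rewrite [ltLHS](product_measure1E (@lebesgue_measure R) (lebesgue_rV n)
  (measurable_itv _) (measurable_open_box _ _)).
rewrite lte_mul_pinfty//; rewrite /= lebesgue_measure_itv/=.
by case: ifP => _ //; rewrite lte_fin; lra.
Qed.

Lemma bounded_coord n (D : set 'rV[R]_n) : bounded_set D ->
  exists M : R, forall x, D x -> forall i, (`|x ord0 i| <= M)%R.
Proof.
move=> [M [_ DM]]; have {}DM := DM (`|M| + 1)%R.
exists (`|M| + 1)%R => x Dx i.
have : (`|x| <= `|M| + 1)%R by apply: DM => //; have := ler_norm M; lra.
rewrite [X in (X <= _)%R]mx_normrE; apply: le_trans.
exact: (le_bigmax _ (fun ij : 'I_1 * 'I_n => `|x ij.1 ij.2|%R) (ord0, i)).
Qed.

Lemma bounded_lebesgue_rV n (D : set 'rV[R]_n) :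
  measurable D -> bounded_set D -> lebesgue_rV n D < +oo.
Proof.
move=> mD /bounded_coord[M DM].
apply: le_lt_trans (lebesgue_rV_open_box n (M + 1)).
apply: le_measure; rewrite ?inE//; first exact: measurable_open_box.
by move=> x Dx i; rewrite !mxE -ltr_norml (le_lt_trans (DM _ Dx i))// ltrDl.
Qed.

End slicing.

Arguments lebesgue_rV : simpl never.

(** * The Gagliardo-Nirenberg-Sobolev inequality *)

Section gagliardo_nirenberg.
Context {R : realType}.
Local Open Scope ereal_scope.

(* The inequality |f(x)| <= \int |d_i f| along the line through x parallel to
   the i-th axis is all that the argument uses about a test function f. *)
Definition line_dominated m (f : 'rV[R]_m -> \bar R)
    (g : 'I_m -> 'rV[R]_m -> \bar R) :=
  forall i x, f x <= \int[lebesgue_measure]_t g i (set_coord i x t).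

Definition nonneg_measurable m (f : 'rV[R]_m -> \bar R) :=
  measurable_fun [set: 'rV[R]_m] f /\ forall x, 0 <= f x.

(* The inequality dual to ||f||_{(m+1)/m} <= \sum_i ||g_i||_1 in dimension
   m + 1. In this form it makes sense for m = 0 and can be applied to each
   slice of f with a weight that does not depend on the slice. *)
Definition weighted_gns m := forall (f I : 'rV[R]_m.+1 -> \bar R) g,
  nonneg_measurable f -> nonneg_measurable I ->
  (forall i, nonneg_measurable (g i)) -> line_dominated f g ->
  \int[lebesgue_rV m.+1]_x (I x `^ m.+1%:R^-1 * f x) <=
  (\int[lebesgue_rV m.+1]_x I x) `^ m.+1%:R^-1 *
  \sum_(i < m.+1) \int[lebesgue_rV m.+1]_x g i x.

Lemma rV_consK n (x : 'rV[R]_n.+1) :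
  rV_cons (x ord0 ord0, \row_j x ord0 (lift ord0 j)) = x.
Proof.
apply/rowP => j; case: (unliftP ord0 j) => [k ->|->].
  by rewrite rV_consS/= mxE.
by rewrite rV_cons0.
Qed.

(** In dimension one the line through x is the whole space, so f lies below the constant \int g, and
    the weight has exponent 1. *)
Lemma weighted_gns0 : weighted_gns 0.
Proof.
move=> f I g [mf f0] [mI I0] mg fg.
have fle x : f x <= \int[lebesgue_rV 1]_x g ord0 x.
  have [mg0 g0] := mg ord0.
  rewrite integral_rV_cons_swap// integral_dirac//; last first.
    exact: measurable_integral_rV_cons_swap.
  rewrite diracT mul1e; apply: le_trans (fg ord0 x) _.
  rewrite -{1}(rV_consK x); under eq_integral do rewrite set_coord_cons0.
  by rewrite [\row_j _](_ : _ = 0%R)//; apply/rowP => -[].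
rewrite big_ord_recl big_ord0 adde0.
under eq_integral do rewrite invr1 poweRe1//.
rewrite invr1 poweRe1 ?integral_ge0//.
have c0 : 0 <= \int[lebesgue_rV 1]_x g ord0 x.
  by apply: integral_ge0 => x _; exact: (mg ord0).2.
rewrite -ge0_integralZr//; apply: ge0_le_integral => //.
- by move=> x _; rewrite mule_ge0.
- exact: emeasurable_funM.
- exact: emeasurable_funM.
- by move=> x _; rewrite lee_wpmul2l.
Qed.

(** The first axis supplies the weight: I(y) = \int g_0(s, y) ds dominates f on every slice. The
    dual inequality on the slices handles the other axes, and the exponent 1 + 1/(m+1) is N/(N-1)
    for N = m + 2. *)
Lemma weighted_gns_sobolev m (f : 'rV[R]_m.+2 -> \bar R) g :
  weighted_gns m -> nonneg_measurable f ->
  (forall i, nonneg_measurable (g i)) -> line_dominated f g ->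
  \int[lebesgue_rV m.+2]_x f x `^ (1 + m.+1%:R^-1) <=
  (\sum_(i < m.+2) \int[lebesgue_rV m.+2]_x g i x) `^ (1 + m.+1%:R^-1).
Proof.
move=> gnsm [mf f0] mg fg; set t : R := (m.+1%:R^-1)%R.
have t0 : (0 < t)%R by rewrite invr_gt0.
have gge0 i : 0 <= \int[lebesgue_rV m.+2]_x g i x.
  by apply: integral_ge0 => x _; exact: (mg i).2.
pose I y := \int[lebesgue_measure]_s g ord0 (rV_cons (s, y)).
have mI : nonneg_measurable I.
  split; first exact: measurable_integral_rV_cons_swap (mg ord0).1 (mg ord0).2.
  by move=> y; apply: integral_ge0 => s _; exact: (mg ord0).2.
have II : \int[lebesgue_rV m.+1]_y I y = \int[lebesgue_rV m.+2]_x g ord0 x.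
  by rewrite (integral_rV_cons_swap (mg ord0).1 (mg ord0).2).
have fI s y : f (rV_cons (s, y)) <= I y.
  have := fg ord0 (rV_cons (s, y)).
  by under eq_integral do rewrite set_coord_cons0.
have slice h s : nonneg_measurable h ->
    nonneg_measurable (fun y : 'rV[R]_m.+1 => h (rV_cons (s, y))).
  by move=> [mh h0]; split => //; apply: (measurableT_comp mh);
    exact: measurable_rV_cons_slice.
have mf1 : measurable_fun setT (fun x => f x `^ (1 + t)).
  exact: measurable_poweRT.
have mint i : measurable_fun [set: measurableTypeR R] (fun s =>
    \int[lebesgue_rV m.+1]_y g (lift ord0 i) (rV_cons (s, y))).
  exact: measurable_integral_rV_cons (mg _).1 (mg _).2.
have int0 i s : 0 <= \int[lebesgue_rV m.+1]_y g (lift ord0 i) (rV_cons (s, y)).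
  by apply: integral_ge0 => y _; exact: (mg _).2.
rewrite integral_rV_cons//; last by move=> x; exact: poweR_ge0.
apply: (@le_trans _ _ (\int[lebesgue_measure]_s
   ((\int[lebesgue_rV m.+2]_x g ord0 x) `^ t *
    \sum_(i < m.+1) \int[lebesgue_rV m.+1]_y g (lift ord0 i) (rV_cons (s, y))))).
  apply: ge0_le_integral => //.
  - by move=> s _; apply: integral_ge0 => y _; exact: poweR_ge0.
  - exact: (measurable_integral_rV_cons mf1 (fun x => poweR_ge0 _ _)).
  - by apply: measurable_funeM; apply: emeasurable_sum.
  move=> s _; have [mfs fs0] := slice _ s (conj mf f0).
  rewrite -II; apply: le_trans (gnsm (fun y => f (rV_cons (s, y))) I
    (fun i y => g (lift ord0 i) (rV_cons (s, y))) _ mI _ _) => //; last 2 first.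
  - by move=> i; exact: slice.
  - move=> i y; have := fg (lift ord0 i) (rV_cons (s, y)).
    by under eq_integral do rewrite set_coord_consS.
  apply: ge0_le_integral => //.
  - by move=> y _; exact: poweR_ge0.
  - exact: measurable_poweRT.
  - by apply: emeasurable_funM => //; apply: measurable_poweRT; exact: mI.1.
  (* f^(1 + t) <= I^t f since f <= I *)
  move=> y _; rewrite addrC poweRD; last first.
    by rewrite add_neq0_poweRD_def// gt_eqF// addr_gt0.
  rewrite poweRe1// lee_wpmul2r//; apply: ge0_le_poweR => //; exact: ltW.
rewrite ge0_integralZl ?poweR_ge0//; last 2 first.
- exact: emeasurable_sum.
- by move=> s _; apply: sume_ge0.
rewrite ge0_integral_sum//.
under eq_bigr do rewrite -(integral_rV_cons (mg _).1 (mg _).2).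
rewrite addrC poweRD; last first.
  by rewrite add_neq0_poweRD_def// gt_eqF// addr_gt0.
rewrite poweRe1 ?sume_ge0// [in leRHS]big_ord_recl.
apply: lee_pmul; rewrite ?poweR_ge0 ?sume_ge0//.
- by apply: ge0_le_poweR => //; [exact: ltW|rewrite leeDl// sume_ge0].
- by rewrite leeDr.
Qed.

(** Hoelder with weights t = 1/(m+2) and 1 - t turns the strong form back into the dual one in the
    same dimension, since 1/(1-t) = 1 + 1/(m+1). This closes the induction. *)
Lemma weighted_gnsS m : weighted_gns m -> weighted_gns m.+1.
Proof.
move=> gnsm f I g [mf f0] [mI I0] mg fg.
have gge0 i : 0 <= \int[lebesgue_rV m.+2]_x g i x.
  by apply: integral_ge0 => x _; exact: (mg i).2.
have := weighted_gns_sobolev gnsm (conj mf f0) mg fg.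
set S := \sum_(i < _) _; set t : R := (m.+2%:R^-1)%R.
have t01 : (0 < t < 1)%R by rewrite invr_gt0 ltr0n/= invf_lt1// ltr1n.
have -> : (1 + m.+1%:R^-1 = (1 - t)^-1 :> R)%R.
  have m0 : (0 <= m%:R :> R)%R by exact: ler0n.
  rewrite /t -(natr1 m.+1) -(natr1 m); field.
  by repeat (apply/andP; split); apply/lt0r_neq0; lra.
set s := (_^-1)%R => fS.
have S0 : 0 <= S by exact: sume_ge0.
have s0 : (0 < 1 - t)%R by rewrite subr_gt0; case/andP: t01.
have ms : measurable_fun setT (fun x => f x `^ s) by exact: measurable_poweRT.
have := hoelder_weights (lebesgue_rV m.+2) t01 mI ms I0 (fun x => poweR_ge0 _ _).
under eq_integral do rewrite -poweRrM mulVf ?gt_eqF// poweRe1//.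
move=> /le_trans; apply; apply: lee_wpmul2l; first exact: poweR_ge0.
have -> : S = (S `^ s) `^ (1 - t).
  by rewrite -poweRrM mulVf ?gt_eqF// poweRe1.
apply: ge0_le_poweR => //; first exact: ltW.
by apply: integral_ge0 => x _; exact: poweR_ge0.
Qed.

Lemma gagliardo_nirenberg m (f : 'rV[R]_m.+2 -> \bar R) g :
  nonneg_measurable f -> (forall i, nonneg_measurable (g i)) ->
  line_dominated f g ->
  \int[lebesgue_rV m.+2]_x f x `^ (1 + m.+1%:R^-1) <=
  (\sum_(i < m.+2) \int[lebesgue_rV m.+2]_x g i x) `^ (1 + m.+1%:R^-1).
Proof.
apply: weighted_gns_sobolev; elim: m {f g} => [|m]; first exact: weighted_gns0.
exact: weighted_gnsS.
Qed.

End gagliardo_nirenberg.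

(** * The chain rule for powers of |y| and the bound along a line *)

Section abs_power.
Context {R : realType}.
Implicit Types (a y : R) (k : R -> R).

Lemma continuous_abs_powR a : 0 < a -> continuous (fun y : R => `|y| `^ a).
Proof.
move=> a0 y; have [->|y0] := eqVneq y 0.
  rewrite /continuous_at normr0 powR0 ?gt_eqF//.
  apply/cvgrPdist_lt => e e0; have d0 : 0 < e `^ a^-1 by exact: powR_gt0.
  near=> z; rewrite sub0r normrN ger0_norm ?powR_ge0//.
  rewrite (_ : e = (e `^ a^-1) `^ a); last first.
    by rewrite -powRrM mulVf ?gt_eqF// powRr1// ltW.
  apply: gt0_ltr_powR; rewrite ?nnegrE ?powR_ge0//.
apply: (@continuous_comp _ _ _ (fun z : R => `|z|) (fun z => z `^ a)).
  exact: norm_continuous.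
apply/differentiable_continuous/derivable1_diffP/derivable_powR.
by rewrite in_itv/= normr_gt0 y0.
Unshelve. all: by end_near. Qed.

(** The derivative of |y|^a for a > 1; the sign function is 0 at the origin and gives the right
    value there. *)
Definition dabs_powR a y : R := a * `|y| `^ (a - 1) * Num.sg y.

Lemma norm_dabs_powR a y : 1 < a -> `|dabs_powR a y| = a * `|y| `^ (a - 1).
Proof.
move=> a1; have a0 : 0 < a by exact: lt_trans a1.
rewrite /dabs_powR !normrM normr_sg (ger0_norm (ltW a0)) ger0_norm ?powR_ge0//.
have [->|y0] := eqVneq y 0; last by rewrite mulr1.
by rewrite normr0 powR0 ?subr_eq0 ?gt_eqF// !(mulr0, mul0r).
Qed.

Lemma continuous_dabs_powR a : 1 < a -> continuous (dabs_powR a).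
Proof.
move=> a1 y; have a0 : 0 < a by exact: lt_trans a1.
have c : continuous (fun y : R => a * `|y| `^ (a - 1)).
  by move=> z; apply: cvgMl_tmp; apply: continuous_abs_powR; rewrite subr_gt0.
have [y0|y0|->] := ltgtP y 0; last first.
- have := c 0; rewrite /continuous_at normr0 powR0 ?subr_eq0 ?gt_eqF//.
  rewrite mulr0 {2}/dabs_powR sgr0 mulr0 => c0.
  apply/norm_cvg0P; apply: cvg_trans c0; apply: near_eq_cvg.
  by apply: nearW => z; rewrite norm_dabs_powR.
- rewrite /continuous_at {2}/dabs_powR gtr0_sg// mulr1.
  apply: cvg_trans (c y); apply: near_eq_cvg; near=> z.
  rewrite /dabs_powR gtr0_sg ?mulr1//; near: z; exact: lt_nbhsr.
- rewrite /continuous_at {2}/dabs_powR ltr0_sg// mulrN1.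
  apply: cvg_trans (cvgN (c y)); apply: near_eq_cvg; near=> z.
  rewrite /dabs_powR ltr0_sg ?mulrN1//; near: z; exact: lt_nbhsl.
Unshelve. all: by end_near. Qed.

(** Away from 0 this is the rule for powers of y or of -y. At 0 the difference quotient has modulus
    |h|^(a-1), which tends to 0. *)
Lemma is_derive_abs_powR a y : 1 < a ->
  is_derive y 1 (fun z : R => `|z| `^ a) (dabs_powR a y).
Proof.
move=> a1; have a0 : 0 < a by exact: lt_trans a1.
have [y0|y0|->] := ltgtP y 0; last first.
- have cv : h^-1 *: (((fun z : R => `|z| `^ a) \o shift 0) (h *: 1) -
      `|0 : R| `^ a) @[h --> (0 : R)^'] --> (0 : R).
    have := @continuous_abs_powR (a - 1) _ 0; rewrite subr_gt0 => /(_ a1).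
    rewrite /continuous_at normr0 powR0 ?subr_eq0 ?gt_eqF// => c0.
    have c1 : `|h| `^ (a - 1) @[h --> (0 : R)^'] --> (0 : R).
      exact: cvg_within_filter.
    apply/norm_cvg0P; apply: (cvg_trans _ c1).
    apply: near_eq_cvg; near=> h => /=.
    have h0 : h != 0 by near: h; exact: nbhs_dnbhs_neq.
    rewrite powR0 ?gt_eqF// subr0 addr0 /GRing.scale/= mulr1 normrM.
    rewrite (ger0_norm (powR_ge0 _ _)) normfV powRB ?powRr1 1?mulrC//.
    by rewrite normr_eq0 h0 implybT.
  split; first by apply/cvg_ex; exists 0.
  by rewrite /dabs_powR sgr0 mulr0; exact: cvg_lim.
- have H : is_derive y 1 ((@powR R) ^~ a) (dabs_powR a y).
    by rewrite /dabs_powR gtr0_sg// mulr1 gtr0_norm//; exact: is_derive1_powR.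
  apply: near_eq_is_derive H.
  by near=> z; rewrite gtr0_norm//; near: z; exact: lt_nbhsr.
- have H : is_derive y 1 (((@powR R) ^~ a) \o -%R) (dabs_powR a y).
    rewrite /dabs_powR ltr0_sg// ltr0_norm//.
    by apply: is_derive1_comp; apply: is_derive1_powR; rewrite oppr_gt0.
  apply: near_eq_is_derive H.
  by near=> z; rewrite /= ltr0_norm//; near: z; exact: lt_nbhsl.
Unshelve. all: by end_near. Qed.

(** The fundamental theorem of calculus on [b, s]: because a > 1, |k|^a is of class C^1 even where k
    changes sign, and it vanishes at b. *)
Lemma abs_powR_le_integral a k (s b : R) : 1 < a ->
  (forall t, derivable k t 1) -> continuous (k^`())%classic ->
  (forall t, t <= b -> k t = 0) ->
  ((`|k s| `^ a)%:E <=
   \int[lebesgue_measure]_t (a * `|k t| `^ (a - 1) * `|k^`()%classic t|)%:E)%E.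
Proof.
move=> a1 dk ck' k0; have a0 : 0 < a by exact: lt_trans a1.
have ck : continuous k.
  by move=> t; exact/differentiable_continuous/derivable1_diffP.
pose F t := `|k t| `^ a; pose f t := dabs_powR a (k t) * k^`()%classic t.
have dF (t : R) : is_derive t 1 F (f t).
  apply: (@is_derive1_comp _ (fun z : R => `|z| `^ a) k).
    exact: is_derive_abs_powR.
  by split => //; rewrite derive1E.
have cf : continuous f.
  move=> t; apply: cvgM; last exact: ck'.
  by apply: continuous_comp; [exact: ck|exact: continuous_dabs_powR].
have cF : continuous F.
  by move=> t; exact/differentiable_continuous/derivable1_diffP.
have mf : measurable_fun [set: R] f by exact: continuous_measurable_fun.
have normf t : (`|(f t)%:E| = (a * `|k t| `^ (a - 1) * `|k^`()%classic t|)%:E)%E.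
  by rewrite /= normrM norm_dabs_powR.
have [sb|bs] := leP s b.
  rewrite k0// normr0 powR0 ?gt_eqF//; apply: integral_ge0 => t _.
  by rewrite -normf.
have -> : `|k s| `^ a = F s - F b.
  by rewrite /F (k0 b)// normr0 powR0 ?gt_eqF// subr0.
have := @continuous_FTC2 _ f F b s bs.
rewrite EFinB => <-; last 3 first.
- exact: continuous_subspaceT.
- split; first by move=> t _; apply: ex_derive.
    by apply: cvg_at_right_filter; exact: cF.
  by apply: cvg_at_left_filter; exact: cF.
- by move=> t _; rewrite derive1E; apply: derive_val.
apply: le_trans (lee_abs _) _; apply: le_trans (le_abse_integral _ _ _) _ => //.
  exact/measurable_EFinP/measurable_funTS.
apply: le_trans (_ : _ <= \int[lebesgue_measure]_t `|(f t)%:E|)%E _.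
  apply: ge0_subset_integral => //.
  exact/measurableT_comp/measurable_EFinP.
by under eq_integral do rewrite normf.
Qed.

End abs_power.

(** * The Sobolev inequality for C^1 functions *)

Section sobolev_test.
Context {R : realType}.

(** Contains the real and imaginary parts of test functions and is stable under differences. The
    bound on f makes all powers of |f| integrable over a bounded D. *)
Definition C1_test n (D : set 'rV[R]_n) (f : 'rV[R]_n -> R) :=
  [/\ continuous f,
      forall i x, derivable f x (delta_mx ord0 i),
      forall i, continuous (partial i f),
      exists M : R, forall x, `|f x| <= M &
      forall x, ~ D x -> f x = 0].

Lemma set_coordE n (i : 'I_n) (x : 'rV[R]_n) (h t : R) :
  set_coord i x (h + t) = h *: delta_mx ord0 i + set_coord i x t.
Proof.
apply/rowP => j; rewrite !mxE eqxx/=.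
by case: eqP => _; rewrite ?mulr1 ?mulr0 ?add0r.
Qed.

Lemma set_coord_id n (i : 'I_n) (x : 'rV[R]_n) : set_coord i x (x ord0 i) = x.
Proof. by apply/rowP => j; rewrite mxE; case: eqP => [->|]. Qed.

Lemma bounded_powR_lty n (D : set 'rV[R]_n) (f : 'rV[R]_n -> R)
    (s M : R) : measurable D -> bounded_set D ->
  measurable_fun D f -> 0 <= s -> (forall x, `|f x| <= M) ->
  (\int[lebesgue_rV n]_(x in D) (`|f x| `^ s)%:E < +oo)%E.
Proof.
move=> mD bD mf s0 fM; have M0 : 0 <= M by exact: le_trans (fM 0).
apply: (@le_lt_trans _ _ (\int[lebesgue_rV n]_(x in D) (M `^ s)%:E)%E).
  apply: ge0_le_integral => //; first exact: measurable_abs_powR.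
  by move=> x _; rewrite lee_fin ge0_ler_powR ?nnegrE.
rewrite integral_cst//= lte_mul_pinfty ?lee_fin ?powR_ge0//.
exact: bounded_lebesgue_rV.
Qed.

Section line.
Context n (i : 'I_n) (f : 'rV[R]_n -> R) (x : 'rV[R]_n).

Let quotientE (t : R) :
  (fun h : R => h^-1 *: (((fun t => f (set_coord i x t)) \o shift t) (h *: 1)
    - f (set_coord i x t))) =
  (fun h : R => h^-1 *: ((f \o shift (set_coord i x t)) (h *: delta_mx ord0 i)
    - f (set_coord i x t))).
Proof.
by apply/funext => h /=; rewrite -set_coordE /GRing.scale/= mulr1.
Qed.

Lemma derivable_line (t : R) :
  derivable f (set_coord i x t) (delta_mx ord0 i) ->
  derivable (fun t => f (set_coord i x t)) t 1.
Proof. by rewrite /derivable quotientE. Qed.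

Lemma derive1_line (t : R) :
  (fun t => f (set_coord i x t))^`()%classic t = partial i f (set_coord i x t).
Proof. by rewrite derive1E /derive quotientE. Qed.

Lemma continuous_line : continuous f -> continuous (fun t => f (set_coord i x t)).
Proof.
move=> cf t; apply: (@continuous_comp _ _ _ (set_coord i x) f); last exact: cf.
rewrite (_ : set_coord i x =
    fun s => s *: delta_mx ord0 i + set_coord i x 0); last first.
  by apply/funext => s; rewrite -set_coordE addr0.
by apply: cvgD; [apply: cvgZl; exact: cvg_id|exact: cvg_cst].
Qed.

End line.

Lemma measurable_C1_test n (D : set 'rV[R]_n) f : C1_test D f ->
  measurable_fun setT f /\ forall i, measurable_fun setT (partial i f).
Proof. by move=> [? _ ? _ _]; split => [|i]; exact: continuous_measurable_rV. Qed.

Lemma C1_test_line_dominated n (D : set 'rV[R]_n) f (a : R) : 1 < a ->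
  bounded_set D -> C1_test D f ->
  line_dominated (fun x => (`|f x| `^ a)%:E)
    (fun i x => (a * `|f x| `^ (a - 1) * `|partial i f x|)%:E).
Proof.
move=> a1 /bounded_coord[M DM] [cf df cf' _ f0] i x.
pose k t := f (set_coord i x t).
rewrite -{1}(set_coord_id i x).
under eq_integral do rewrite -derive1_line.
(* [- |M| - 1] lies to the left of the projection of [D] to the i-th axis, so f vanishes on the line
   up to that point. *)
apply: (@abs_powR_le_integral _ a k _ (- `|M| - 1)) => //.
- by move=> t; apply: derivable_line.
- rewrite (_ : _^`()%classic = fun t => partial i f (set_coord i x t)).
    exact: continuous_line.
  by apply/funext => t; rewrite derive1_line.
- move=> t tM; apply: f0 => /DM /(_ i); rewrite mxE eqxx => tM'.
  by have := ler_norm (- t); have := ler_norm M; rewrite normrN; lra.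
Qed.


(** Since 1/k = 1/P + s, taking k-th roots and dividing by x^s leaves x^(1/P) <= c y^(1/p). The
    division requires x to be finite, whence the real-valued form. *)
Lemma absorb_powR (c k P s p x y : R) : 0 <= c -> 0 < k -> 0 < P ->
  k^-1 = P^-1 + s -> 0 <= x -> 0 <= y ->
  x <= (c * (x `^ s * y `^ p^-1)) `^ k -> x <= c `^ P * y `^ (P / p).
Proof.
move=> c0 k0 P0 kP x0 y0 xG.
have [->|xn0] := eqVneq x 0; first by rewrite mulr_ge0 ?powR_ge0.
have {}x0 : 0 < x by rewrite lt_neqAle eq_sym xn0.
have w0 : 0 <= c * (x `^ s * y `^ p^-1).
  by rewrite mulr_ge0// mulr_ge0 ?powR_ge0.
have : x `^ k^-1 <= c * (x `^ s * y `^ p^-1).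
  rewrite [leRHS](_ : _ = ((c * (x `^ s * y `^ p^-1)) `^ k) `^ k^-1); last first.
    by rewrite -powRrM mulfV ?gt_eqF// powRr1.
  by apply: ge0_ler_powR => //; rewrite ?nnegrE ?powR_ge0 ?invr_ge0 ?ltW.
rewrite kP powRD; last by rewrite xn0 implybT.
rewrite mulrCA [X in X <= _]mulrC ler_pM2l ?powR_gt0// => xw.
have -> : y `^ (P / p) = (y `^ p^-1) `^ P by rewrite -powRrM mulrC.
rewrite -(powRM _ c0 (powR_ge0 _ _)).
rewrite (_ : x = (x `^ P^-1) `^ P); last first.
  by rewrite -powRrM mulVf ?gt_eqF// powRr1// ltW.
by apply: ge0_ler_powR; rewrite ?nnegrE ?powR_ge0 ?mulr_ge0 ?powR_ge0 ?(ltW P0).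
Qed.

Section exponents.
Context (m : nat) (p : R).
Hypotheses (p1 : 1 < p) (pm : p < m.+2%:R).
Local Notation N := (m.+2%:R : R).

Definition sobolev_exponent : R := N * p / (N - p).
Local Notation P := sobolev_exponent.

(* The power of |f| to which the Gagliardo-Nirenberg inequality is applied:
   a N / (N - 1) = (a - 1) p / (p - 1) = P. *)
Let a : R := p * (N - 1) / (N - p).
Let Np0 : 0 < N - p. Proof. by rewrite subr_gt0. Qed.
Let p0 : 0 < p. Proof. exact: lt_trans p1. Qed.
Let N1 : 0 < N - 1. Proof. by rewrite subr_gt0 ltr1n. Qed.
Let N0 : 0 < N. Proof. by rewrite ltr0n. Qed.

Lemma sobolev_exponent_gt : p < P.
Proof. by rewrite /P ltr_pdivlMr// mulrC ltr_pM2r// gtrBl. Qed.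

Lemma sobolev_exponent_gt0 : 0 < P.
Proof. exact: lt_trans sobolev_exponent_gt. Qed.

Let a1 : 1 < a.
Proof. by rewrite /a ltr_pdivlMr// mul1r mulrBr mulr1 ltrD2r ltr_pMl. Qed.

Let Na : a * (1 + m.+1%:R^-1) = P.
Proof.
have E : m.+1%:R = N - 1 :> R by rewrite -[in RHS]natr1 addrK.
rewrite /P /a E; have := lt0r_neq0 Np0; have := lt0r_neq0 N1.
by move: N => n n1 np; field; rewrite np n1.
Qed.

Let aP : (a - 1) = P * (1 - p^-1).
Proof.
rewrite /P /a; have := lt0r_neq0 Np0; have := lt0r_neq0 p0.
by move: N => n p_neq0 np; field; rewrite np p_neq0.
Qed.

(** The balance of exponents behind the absorption. Multiplied by a (1 + 1/(m+1)) = P it becomes a =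
    1 + (a - 1), by [Na] and [aP]. *)
Let kP : (1 + m.+1%:R^-1)^-1 = P^-1 + (1 - p^-1).
Proof.
have a0 : 0 < a by exact: lt_trans a1.
have P0 := sobolev_exponent_gt0.
have k0 : 0 < 1 + m.+1%:R^-1 :> R by rewrite addr_gt0.
move: (1 + m.+1%:R^-1) Na k0 => k ak k0.
apply: (mulfI (lt0r_neq0 k0)); rewrite mulfV ?gt_eqF//.
apply: (mulfI (lt0r_neq0 a0)); rewrite mulr1 mulrA ak mulrDr -aP.
by rewrite mulfV ?gt_eqF// subrKC.
Qed.

(** Hoelder splits a |f|^(a-1) |d_i f| so that X, the integral of |f|^P, comes back on the right
    with exponent 1 - 1/p. It can be absorbed because X is finite, f being bounded on a set of
    finite measure. *)
Lemma sobolev_C1_test (D : set 'rV[R]_m.+2) (f : 'rV[R]_m.+2 -> R) :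
  measurable D -> bounded_set D -> C1_test D f ->
  (\int[lebesgue_rV m.+2]_x (`|f x| `^ P)%:E <=
   ((N * a) `^ P)%:E *
   (\sum_(i < m.+2) \int[lebesgue_rV m.+2]_(x in D) (`|partial i f x| `^ p)%:E)
     `^ (P / p))%E.
Proof.
move=> mD bD tf; have [mf mdf] := measurable_C1_test tf.
have [_ _ _ [M fM] f0] := tf.
have a0 : 0 < a by exact: lt_trans a1.
have P0 := sobolev_exponent_gt0.
pose g i x := ((a * `|f x| `^ (a - 1) * `|partial i f x|)%:E : \bar R).
set X := (\int[_]_x _)%E; set Y := (\sum_(i < _) _)%E.
pose Yi i := (\int[lebesgue_rV m.+2]_(x in D) (`|partial i f x| `^ p)%:E)%E.
have Yi0 i : (0 <= Yi i)%E.
  by apply: integral_ge0 => x _; rewrite lee_fin powR_ge0.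
have X0 : (0 <= X)%E by apply: integral_ge0 => x _; rewrite lee_fin powR_ge0.
have XD : X = (\int[lebesgue_rV m.+2]_(x in D) (`|f x| `^ P)%:E)%E.
  rewrite [RHS]integral_mkcond; apply: eq_integral => x _; rewrite patchE.
  case: ifPn => // /negP xD; rewrite f0 ?normr0 ?powR0 ?gt_eqF//.
  by move=> Dx; apply: xD; rewrite inE.
have Xfin : (X < +oo)%E.
  by rewrite XD; exact: bounded_powR_lty mD bD (measurable_funTS mf) (ltW P0) fM.
have mg i : nonneg_measurable (g i).
  split; last first.
    by move=> x; rewrite lee_fin mulr_ge0// mulr_ge0 ?powR_ge0// ltW.
  apply/measurable_EFinP; apply: measurable_funM; last exact: measurableT_comp.
  by apply: measurable_funM => //; exact/measurable_EFinP/measurable_abs_powR.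
have gle i : (\int[lebesgue_rV m.+2]_x g i x <=
    a%:E * (X `^ (1 - p^-1) * Yi i `^ p^-1))%E.
  have t01 : 0 < p^-1 < 1 by rewrite invr_gt0 p0 invf_lt1.
  have := hoelder_weights_on (lebesgue_rV m.+2) mD t01
    (measurable_abs_powR p (measurable_funTS (mdf i)))
    (measurable_abs_powR P (measurable_funTS mf)).
  move=> /(_ (fun _ _ => powR_ge0 _ _) (fun _ _ => powR_ge0 _ _)).
  rewrite -XD muleC => /(lee_wpmul2l (ltW a0 : 0 <= a%:E)%E).
  apply: le_trans; rewrite -ge0_integralZl//; last 3 first.
  - by apply: emeasurable_funM; apply: measurable_funTS; apply: measurable_poweRT;
      exact: measurable_abs_powR.
  - by move=> x _; rewrite mule_ge0 ?poweR_ge0.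
  - by rewrite lee_fin ltW.
  rewrite [leRHS]integral_mkcond le_eqVlt; apply/orP; left; apply/eqP.
  apply: eq_integral => x _.
  rewrite patchE; case: ifPn => [_|/negP xD].
    rewrite /g !poweR_EFin -!EFinM -!powRrM mulfV ?gt_eqF// powRr1// -aP.
    by rewrite mulrA [in RHS]mulrAC.
  rewrite /g f0 ?normr0 ?powR0 ?subr_eq0 ?gt_eqF// ?mulr0 ?mul0r//.
  by move=> Dx; apply: xD; rewrite inE.
have := @gagliardo_nirenberg _ m (fun x => (`|f x| `^ a)%:E) g _ mg
  (C1_test_line_dominated a1 bD tf).
move=> /(_ (conj (measurable_abs_powR _ mf) (fun x => powR_ge0 _ _))).
under eq_integral do rewrite poweR_EFin -powRrM Na.
rewrite -/X => XG.
have Y0 : (0 <= Y)%E by apply: sume_ge0 => i _; exact: Yi0.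
have YiY i : (Yi i <= Y)%E 
  by rewrite /Y (bigD1 i)//= leeDl//; apply: sume_ge0 => j _; exact: Yi0.
(* Each of the N terms is estimated with the full sum [Y] in place of [Yi i]; this is the origin of
   the constant N a. *)
have {}XG : (X <= ((N * a)%:E * (X `^ (1 - p^-1) * Y `^ p^-1)) `^ (1 + m.+1%:R^-1))%E.
  apply: le_trans XG _; apply: ge0_le_poweR.
  - by rewrite addr_ge0.
  - by apply: sume_ge0 => i _; apply: integral_ge0 => x _; exact: (mg i).2.
  rewrite EFinM -muleA [leRHS](_ : _ = \sum_(i < m.+2)
      (a%:E * (X `^ (1 - p^-1) * Y `^ p^-1)))%E.
    apply: lee_sum => i _; apply: le_trans (gle i) _.
    apply: lee_wpmul2l; first by rewrite lee_fin ltW.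
    apply: lee_wpmul2l; first exact: poweR_ge0.
    apply: ge0_le_poweR (Yi0 i) (YiY i); rewrite invr_ge0.
    exact: ltW.
  by rewrite mule_natl sumr_const card_ord.
have C0 : 0 < (N * a) `^ P by apply: powR_gt0; exact: mulr_gt0.
(* [C1_test] does not bound the partial derivatives, so [Y] may be infinite; then the right side is
   +oo because its constant is positive. *)
have [Yoo|Yfin] := eqVneq Y +oo%E.
  have Pp : P / p != 0 by apply: lt0r_neq0; exact: divr_gt0.
  by rewrite Yoo (poweRyr Pp) gt0_muley ?leey// lte_fin.
have xE : X = (fine X)%:E by rewrite fineK ?ge0_fin_numE.
have yE : Y = (fine Y)%:E by rewrite fineK ?ge0_fin_numE ?ltey.
have x0 : 0 <= fine X by exact: fine_ge0.
have y0 : 0 <= fine Y by exact: fine_ge0.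
move: XG; rewrite xE yE !poweR_EFin -!EFinM !lee_fin.
move: (fine X) (fine Y) x0 y0 => x y x0 y0 xG.
have Na0 : 0 <= N * a by rewrite mulr_ge0 ?ltW.
by apply: (absorb_powR _ _ _ kP _ _ xG); rewrite // addr_gt0.
Qed.

End exponents.

End sobolev_test.

(** * Closure of the Sobolev inequality *)

Section lower_semicontinuity.
Context {R : realType}.

(** The sum is at most twice the larger summand. The constant is crude but serves all p >= 0,
    including exponents below 1 where convexity fails. *)
Lemma powRD_le (p a b : R) : 0 <= p -> 0 <= a -> 0 <= b ->
  (a + b) `^ p <= 2 `^ p * (a `^ p + b `^ p).
Proof.
move=> p0; wlog ab : a b / a <= b => [hw a0 b0|a0 b0].
  by have [/hw|/ltW/hw] := leP a b; last rewrite addrC [a `^ p + _]addrC; apply.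
apply: (@le_trans _ _ ((2 * b) `^ p)).
  by rewrite ge0_ler_powR ?nnegrE ?addr_ge0 ?mulr_ge0//; lra.
by rewrite powRM// ler_wpM2l ?powR_ge0// lerDr powR_ge0.
Qed.

(* Replaces the extraction of an almost everywhere convergent subsequence: the
   L^P norm of the truncation of w is controlled by that of f, up to an error
   measured in L^p only. *)
Lemma truncated_powR_le (p P M w f : R) : 0 < p -> p < P -> 0 <= M ->
  Num.min `|w| M `^ P <= 2 `^ P * (`|f| `^ P + M `^ (P - p) * `|w - f| `^ p).
Proof.
move=> p0 pP M0; have P0 : 0 < P by exact: lt_trans pP.
(* Truncation is subadditive: min(|w|, M) <= |f| + d. In d^P = d^(P-p) d^p the first factor is at
   most M^(P-p) and the second at most |w - f|^p. *)
pose d := Num.min `|w - f| M.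
have d0 : 0 <= d by rewrite /d le_min normr_ge0.
apply: (@le_trans _ _ ((`|f| + d) `^ P)).
  rewrite ge0_ler_powR ?nnegrE ?(ltW P0) ?addr_ge0 ?le_min ?normr_ge0//.
  have := ler_normD (w - f) f; rewrite subrK /d => wf.
  by case: (leP `|w| M) => ?; case: (leP `|w - f| M) => ?;
    have := normr_ge0 f; lra.
apply: le_trans (powRD_le (ltW P0) (normr_ge0 _) d0) _.
rewrite ler_wpM2l ?powR_ge0// lerD2l.
have -> : d `^ P = d `^ (P - p) * d `^ p.
  by rewrite -powRD subrK// gt_eqF.
rewrite ler_pM ?powR_ge0//; apply: ge0_ler_powR; rewrite ?nnegrE//.
- by rewrite subr_ge0 ltW.
- by rewrite /d ge_min lexx orbT.
- exact: ltW.
- by rewrite /d ge_min lexx.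
Qed.

Context d {T : measurableType d} (mu : {measure set T -> \bar R}).
Variables (D : set T) (mD : measurable D).
Local Open Scope ereal_scope.

Lemma integral_truncated_le (P : R) (w : T -> R) (c : \bar R) :
  (0 < P)%R -> measurable_fun D w ->
  (forall k : nat, \int[mu]_(x in D) (Num.min `|w x| k%:R `^ P)%:E <= c) ->
  \int[mu]_(x in D) (`|w x| `^ P)%:E <= c.
Proof.
move=> P0 mw le_c.
pose g k x := ((Num.min `|w x| k%:R) `^ P)%:E.
have mg k : measurable_fun D (g k).
  apply/measurable_EFinP.
  apply: (@measurableT_comp _ _ _ _ _ _ (fun x => x `^ P)%R).
    exact: measurable_powR.
  apply: measurable_minr => //; exact: measurableT_comp.
have ndg x : D x -> nondecreasing_seq (g ^~ x).
  move=> _ j k jk; rewrite lee_fin ge0_ler_powR ?nnegrE ?(ltW P0) ?le_min ?normr_ge0//.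
  - exact: ler0n.
  - exact: ler0n.
  - by rewrite !ge_min lexx/= ler_nat jk orbT.
rewrite (eq_integral (fun x => limn (g ^~ x))); last first.
  move=> x _; apply/esym/cvg_lim => //; apply: cvg_near_cst.
  near=> k; rewrite /g min_l//; near: k; exact: nbhs_infty_ger.
rewrite monotone_convergence//; last by move=> k x _; rewrite lee_fin powR_ge0.
apply: lime_le; last by apply: nearW.
apply: ereal_nondecreasing_is_cvgn => j k jk; apply: ge0_le_integral => //.
- by move=> x _; rewrite lee_fin powR_ge0.
- by move=> x Dx; exact: ndg.
Unshelve. all: by end_near. Qed.

Lemma integral_powRD_le (p : R) (f g : T -> R) : (0 <= p)%R ->
  measurable_fun D f -> measurable_fun D g ->
  \int[mu]_(x in D) (`|f x + g x| `^ p)%:E <=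
  (2 `^ p)%:E * (\int[mu]_(x in D) (`|f x| `^ p)%:E +
                 \int[mu]_(x in D) (`|g x| `^ p)%:E).
Proof.
move=> p0 mf mg; have mpf := measurable_abs_powR p mf.
have mpg := measurable_abs_powR p mg.
rewrite -ge0_integralD//; try by move=> x _; rewrite lee_fin powR_ge0.
rewrite -ge0_integralZl//; last 2 first.
- exact: emeasurable_funD.
- by move=> x _; rewrite -EFinD lee_fin addr_ge0 ?powR_ge0.
apply: ge0_le_integral => //.
- by apply: measurable_abs_powR; exact: measurable_funD.
- by apply: measurable_funeM; exact: emeasurable_funD.
move=> x _; rewrite -EFinD -EFinM lee_fin.
apply: le_trans (powRD_le p0 (normr_ge0 _) (normr_ge0 _)).
by rewrite ge0_ler_powR ?nnegrE ?addr_ge0// ler_normD.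
Qed.

End lower_semicontinuity.

Section sobolev_closure.
Context {R : realType}.

Definition C1_approximable n (D : set 'rV[R]_n) (p : R) (w : 'rV[R]_n -> R)
    (h : 'I_n -> 'rV[R]_n -> R) := forall e : R, 0 < e ->
  exists2 f, C1_test D f &
    (\int[lebesgue_rV n]_(x in D) (`|w x - f x| `^ p)%:E <= e%:E)%E /\
    forall i, (\int[lebesgue_rV n]_(x in D)
                 (`|h i x - partial i f x| `^ p)%:E <= e%:E)%E.

Local Open Scope ereal_scope.

(** The real number y lies strictly above the gradient integral, and the gap pays for the
    approximation error of the gradients. C depends on m and p only, and y is free, so that it can
    also be sent to 0. *)
Lemma sobolev_closure (m : nat) (p : R) : (1 < p)%R -> (p < m.+2%:R)%R ->
  exists2 C : R, (0 <= C)%R & forall (D : set 'rV[R]_m.+2) w h (y : R),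
    measurable D -> bounded_set D -> measurable_fun D w ->
    (forall i, measurable_fun D (h i)) -> C1_approximable D p w h ->
    \sum_(i < m.+2) \int[lebesgue_rV m.+2]_(x in D) (`|h i x| `^ p)%:E < y%:E ->
    \int[lebesgue_rV m.+2]_(x in D) (`|w x| `^ sobolev_exponent m p)%:E <=
    (C * y `^ (sobolev_exponent m p / p))%:E.
Proof.
move=> p1 pm; have p0 : (0 < p)%R by exact: lt_trans p1.
pose N : R := m.+2%:R; have N0 : (0 < N)%R by rewrite ltr0n.
pose P := sobolev_exponent m p.
have P0 : (0 < P)%R by exact: sobolev_exponent_gt0.
have pP : (p < P)%R by exact: sobolev_exponent_gt.
pose C0 : R := ((N * (p * (N - 1) / (N - p))) `^ P)%R.
(* 2^P comes from the truncation, [C0] from the inequality for C^1 functions, and 2^p from comparing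
   the gradient of the approximant with h. *)
exists (2 `^ P * (C0 * (2 `^ p) `^ (P / p)))%R.
  by rewrite !mulr_ge0 ?powR_ge0.
move=> D w h y mD bD mw mh wh.
set Y := \sum_(i < _) _ => Yy.
pose mu := @lebesgue_rV R m.+2.
have Y0 : 0 <= Y.
  by apply: sume_ge0 => i _; apply: integral_ge0 => x _; rewrite lee_fin powR_ge0.
have YE : Y = (fine Y)%:E by rewrite fineK ?ge0_fin_numE// (lt_trans Yy) ?ltry.
have {}Yy : (fine Y < y)%R by rewrite -lte_fin -YE.
apply: integral_truncated_le => // k.
apply/lee_addgt0Pr => e e0.
(* The first bound gives Y + N b <= y, the second 2^P k^(P-p) b <= e. The added 1 keeps the
   denominator positive for k = 0. *)
pose b : R := Num.min ((y - fine Y) / N)%R (e / (2 `^ P * (k%:R `^ (P - p) + 1)))%R.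
have b0 : (0 < b)%R.
  rewrite lt_min !divr_gt0 ?subr_gt0// mulr_gt0 ?powR_gt0//.
have [f tf [wf hf]] := wh b b0.
have [mf mdf] := measurable_C1_test tf.
have fY : \sum_(i < m.+2) \int[mu]_(x in D) (`|partial i f x| `^ p)%:E <=
    (2 `^ p * y)%:E.
  apply: (@le_trans _ _ (\sum_(i < m.+2) (2 `^ p)%:E *
      (\int[mu]_(x in D) (`|h i x| `^ p)%:E + b%:E))).
    apply: lee_sum => i _; have := integral_powRD_le mu mD (ltW p0) (mh i)
      (measurable_funB (measurable_funTS (mdf i)) (mh i)).
    under eq_integral do rewrite subrKC.
    move=> /le_trans; apply; rewrite lee_pmul2l// ?lte_fin ?powR_gt0//.
    apply: leeD2l; under eq_integral do rewrite distrC.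
    exact: hf.
  rewrite -ge0_sume_distrr; last first.
    move=> i _; rewrite adde_ge0 ?lee_fin ?(ltW b0)//.
    by apply: integral_ge0 => x _; rewrite lee_fin powR_ge0.
  rewrite EFinM lee_pmul2l// ?lte_fin ?powR_gt0//.
  rewrite [X in X <= _](_ : _ = (fine Y)%:E + N%:E * b%:E); last first.
    by rewrite mule_natl -YE big_split sumr_const card_ord.
  rewrite -EFinM -EFinD lee_fin.
  have : (b <= (y - fine Y) / N)%R by rewrite ge_min lexx.
  by rewrite ler_pdivlMr// -/N; lra.
have fX : \int[mu]_(x in D) (`|f x| `^ P)%:E <= (C0 * (2 `^ p * y) `^ (P / p))%:E.
  have Xle : \int[mu]_(x in D) (`|f x| `^ P)%:E <= \int[mu]_x (`|f x| `^ P)%:E.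
    by apply: ge0_subset_integral => //; exact: measurable_abs_powR.
  apply: le_trans Xle _; apply: le_trans (sobolev_C1_test p1 pm mD bD tf) _.
  rewrite EFinM -poweR_EFin lee_wpmul2l ?lee_fin ?powR_ge0//.
  apply: ge0_le_poweR fY; first by rewrite divr_ge0 ?ltW.
  by apply: sume_ge0 => i _; apply: integral_ge0 => x _; rewrite lee_fin powR_ge0.
pose c : R := (k%:R `^ (P - p))%R.
have c0 : (0 <= c)%R by exact: powR_ge0.
have mfP : measurable_fun D (fun x => (`|f x| `^ P)%:E).
  by apply: measurable_abs_powR; exact: measurable_funTS.
have mwf : measurable_fun D (fun x => (`|w x - f x| `^ p)%:E).
  by apply: measurable_abs_powR; apply: measurable_funB => //; exact: measurable_funTS.
apply: (@le_trans _ _ (\int[mu]_(x in D)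
    ((2 `^ P)%:E * ((`|f x| `^ P)%:E + c%:E * (`|w x - f x| `^ p)%:E)))).
  apply: ge0_le_integral => //.
  - apply/measurable_EFinP.
    apply: (@measurableT_comp _ _ _ _ _ _ (fun x => x `^ P)%R).
      exact: measurable_powR.
    by apply: measurable_minr => //; exact: measurableT_comp.
  - apply: measurable_funeM; apply: emeasurable_funD => //.
    exact: measurable_funeM.
  - by move=> x _; rewrite -EFinM lee_fin; exact: truncated_powR_le.
rewrite ge0_integralZl ?lee_fin ?powR_ge0//; last 2 first.
- by apply: emeasurable_funD => //; exact: measurable_funeM.
- by move=> x _; rewrite -EFinM -EFinD lee_fin addr_ge0 ?mulr_ge0 ?powR_ge0.
rewrite ge0_integralD//; last 2 first.
- by move=> x _; rewrite -EFinM lee_fin mulr_ge0 ?powR_ge0.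
- exact: measurable_funeM.
rewrite ge0_integralZl//.
apply: (@le_trans _ _ ((2 `^ P)%:E * ((C0 * (2 `^ p * y) `^ (P / p))%:E + c%:E * b%:E))).
  rewrite lee_pmul2l// ?lte_fin ?powR_gt0//; apply: leeD => //.
  by apply: lee_wpmul2l => //; rewrite lee_fin.
rewrite -EFinM -EFinD lee_fin mulrDr.
have y0 : (0 <= y)%R by apply: le_trans (ltW Yy); exact: fine_ge0.
rewrite powRM ?powR_ge0// -!mulrA lerD2l.
have be : (b <= e / (2 `^ P * (c + 1)))%R by rewrite ge_min lexx orbT.
have c1 : (0 < 2 `^ P * (c + 1))%R.
  by apply: mulr_gt0; rewrite ?powR_gt0// ltr_wpDl.
move: be; rewrite ler_pdivlMr// => /(le_trans _); apply.
by rewrite [leRHS]mulrCA ler_pM2l ?powR_gt0// [leRHS]mulrC ler_pM2r// lerDl ler01.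
Qed.

End sobolev_closure.

(** * Extended sequences tending to zero *)

Section vanishing.
Context {R : realType}.
Local Open Scope ereal_scope.
Implicit Types a b : nat -> \bar R.

(** One-sided, hence equivalent to convergence to 0 for nonnegative sequences only. It allows
    comparison from above while the first terms may be infinite. *)
Definition vanishing a :=
  forall e : R, (0 < e)%R -> \forall k \near \oo, a k <= e%:E.

Lemma vanishing_le a b : (forall k, a k <= b k) -> vanishing b -> vanishing a.
Proof.
by move=> ab vb e /vb; apply: filterS => k; exact: le_trans.
Qed.

Lemma vanishingD a b : vanishing a -> vanishing b ->
  vanishing (fun k => a k + b k).
Proof.
move=> va vb e e0; have e2 : (0 < e / 2)%R by rewrite divr_gt0.
apply: filterS2 (va _ e2) (vb _ e2) => k ak bk.
by rewrite [e]splitr EFinD leeD.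
Qed.

Lemma vanishing_poweR a (t : R) : (0 < t)%R -> (forall k, 0 <= a k) ->
  vanishing a -> vanishing (fun k => a k `^ t).
Proof.
move=> t0 a0 va e e0; apply: filterS (va (e `^ t^-1)%R (powR_gt0 _ e0)) => k ak.
rewrite (_ : e%:E = (e `^ t^-1)%:E `^ t); last first.
  by rewrite poweR_EFin -powRrM mulVf ?gt_eqF// powRr1// ltW.
by apply: ge0_le_poweR => //; exact: ltW.
Qed.

Lemma vanishingZl a (c : R) : (0 <= c)%R -> vanishing a ->
  vanishing (fun k => c%:E * a k).
Proof.
move=> c0 va e e0; have c1 : (0 < c + 1)%R by rewrite ltr_wpDl.
apply: filterS (va (e / (c + 1))%R (divr_gt0 e0 c1)) => k ak.
apply: (@le_trans _ _ (c%:E * (e / (c + 1))%:E)).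
  by apply: lee_wpmul2l; rewrite ?lee_fin.
by rewrite -EFinM lee_fin mulrCA ger_pMr// ler_pdivrMr// mul1r lerDl.
Qed.

Lemma cvg0_vanishing a : a k @[k --> \oo] --> 0 -> vanishing a.
Proof.
move=> /fine_cvgP[afin a0] e e0.
near=> k; have ak : a k \is a fin_num by near: k.
rewrite -(fineK ak) lee_fin (le_trans (ler_norm _))//; near: k.
exact: (cvgr0_norm_le _ a0 _ e0).
Unshelve. all: by end_near. Qed.

Lemma vanishing_forall (I : finType) (a : I -> nat -> \bar R) (e : R) :
  (forall i, vanishing (a i)) -> (0 < e)%R ->
  \forall k \near \oo, forall i, a i k <= e%:E.
Proof.
move=> va e0.
by apply: (@filter_forall nat I (fun i k => a i k <= e%:E)) => i; exact: va.
Qed.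

End vanishing.

(** * Continuity of pairings with a fixed weight *)

Section pairing.
Context d {T : measurableType d} {R : realType}.
Variables (mu : {measure set T -> \bar R}) (D : set T) (mD : measurable D).
Local Open Scope ereal_scope.

(** The weight G is known only through a Hoelder bound on its pairings, so that the gradient side (s
    = p) and the potential side (s = q) of the equation share one argument: the bound is applied to
    F - Fk. *)
Lemma pairing_cvg (s K : R) (G F : T -> R) (Fk : nat -> T -> R) :
  (0 < s)%R -> (0 <= K)%R -> measurable_fun D G -> measurable_fun D F ->
  (forall k, measurable_fun D (Fk k)) ->
  (forall H, measurable_fun D H ->
    \int[mu]_(x in D) `|G x * H x|%:E <=
    K%:E * (\int[mu]_(x in D) (`|H x| `^ s)%:E) `^ s^-1) ->
  \int[mu]_(x in D) (`|F x| `^ s)%:E < +oo ->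
  (forall k, \int[mu]_(x in D) (`|Fk k x| `^ s)%:E < +oo) ->
  vanishing (fun k => \int[mu]_(x in D) (`|F x - Fk k x| `^ s)%:E) ->
  [/\ mu.-integrable D (EFin \o (fun x => G x * F x)%R),
      forall k, mu.-integrable D (EFin \o (fun x => G x * Fk k x)%R) &
      (\int[mu]_(x in D) (G x * Fk k x))%R @[k --> \oo] -->
      (\int[mu]_(x in D) (G x * F x))%R].
Proof.
move=> s0 K0 mG mF mFk GH Foo Fkoo vF.
have int (H : T -> R) : measurable_fun D H ->
    \int[mu]_(x in D) (`|H x| `^ s)%:E < +oo ->
    mu.-integrable D (EFin \o (fun x => G x * H x)%R).
  move=> mH Hoo; apply/integrableP; split.
    by apply/measurable_EFinP; exact: measurable_funM.
  apply: le_lt_trans (GH _ mH) _; rewrite lte_mul_pinfty ?lee_fin//.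
  exact: poweR_lty.
have iF := int _ mF Foo; have iFk k := int _ (mFk k) (Fkoo k).
split=> //.
apply/cvgrPdist_le => e e0.
have v0 : vanishing (fun k =>
    K%:E * (\int[mu]_(x in D) (`|F x - Fk k x| `^ s)%:E) `^ s^-1).
  apply: vanishingZl => //; apply: vanishing_poweR => //; first by rewrite invr_gt0.
  by move=> k; apply: integral_ge0 => x _; rewrite lee_fin powR_ge0.
apply: filterS (v0 e e0) => k.
have mB : measurable_fun D (F \- Fk k)%R by exact: measurable_funB.
move=> /(le_trans (GH _ mB)) le_e.
rewrite -(RintegralB mD iF (iFk k)).
have iGB : mu.-integrable D (EFin \o (fun x => G x * F x - G x * Fk k x)%R).
  by have := integrableB mD iF (iFk k).
rewrite -lee_fin EFin_normr_Rintegral//; apply: le_trans le_e.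
apply: le_trans (le_abse_integral mu mD (measurable_int _ iGB)) _.
by under eq_integral do rewrite /= -mulrBr.
Qed.

End pairing.

(** * The embedding for limits of test functions *)

Section sobolev_limits.
Context {R : realType} {n : nat}.
Implicit Types (D : set 'rV[R]_n) (w : 'rV[R]_n -> R) (p : R).
Local Notation mu := (@lebesgue_rV R n).

Lemma partialB (f g : 'rV[R]_n -> R) i : (forall x, derivable f x (delta_mx ord0 i)) ->
  (forall x, derivable g x (delta_mx ord0 i)) ->
  partial i (fun x => f x - g x) = (fun x => partial i f x - partial i g x).
Proof. by move=> df dg; apply/funext => x; rewrite /partial deriveB. Qed.

Lemma C1_testB D (f g : 'rV[R]_n -> R) : C1_test D f -> C1_test D g ->
  C1_test D (fun x => f x - g x).
Proof.
move=> [cf df cf' [M fM] f0] [cg dg cg' [N gN] g0]; split.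
- by move=> x; exact: (@continuousB _ _ _ f g _ (cf x) (cg x)).
- by move=> i x; apply: derivableB.
- move=> i; rewrite partialB// => x.
  exact: (@continuousB _ _ _ (partial i f) (partial i g) _ (cf' i x) (cg' i x)).
- exists (M + N) => x; apply: le_trans (ler_normB _ _) _; exact: lerD.
- by move=> x Dx; rewrite f0// g0// subr0.
Qed.

Definition C1_limit D p w (h : 'I_n -> 'rV[R]_n -> R)
    (f : nat -> 'rV[R]_n -> R) :=
  [/\ forall k, C1_test D (f k),
      vanishing (fun k => \int[mu]_(x in D) (`|w x - f k x| `^ p)%:E)%E &
      forall i, vanishing (fun k =>
        \int[mu]_(x in D) (`|h i x - partial i (f k) x| `^ p)%:E)%E].

Lemma C1_limit_approximable D p w h f :
  C1_limit D p w h f -> C1_approximable D p w h.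
Proof.
move=> [tf vw vh] e e0.
have [k [wk hk]] : exists k,
   (\int[mu]_(x in D) (`|w x - f k x| `^ p)%:E <= e%:E)%E /\
   forall i, (\int[mu]_(x in D) (`|h i x - partial i (f k) x| `^ p)%:E <= e%:E)%E.
  apply: (@filter_ex _ \oo); apply: filterI; first exact: vw.
  exact: vanishing_forall.
by exists (f k).
Qed.

(** In the differences f_k cancels. Thus w - f_k is itself a limit of test functions, and the
    Sobolev inequality applies to the error. *)
Lemma C1_limitB D p w h f k : C1_limit D p w h f ->
  C1_limit D p (fun x => w x - f k x)
    (fun i x => h i x - partial i (f k) x) (fun j x => f j x - f k x).
Proof.
move=> [tf vw vh]; split.
- by move=> j; exact: C1_testB.
- apply: vanishing_le vw => j; under eq_integral do rewrite opprB addrA subrK.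
  exact: lexx.
- move=> i; apply: vanishing_le (vh i) => j.
  have [_ dj _ _ _] := tf j; have [_ dk _ _ _] := tf k.
  rewrite partialB//; under eq_integral do rewrite opprB addrA subrK.
  exact: lexx.
Qed.

(** t^q is at most t^p for t <= 1 and at most t^P for t > 1; this pointwise bound takes the place of
    interpolation between the norms. *)
Lemma powR_interpolation (p q P t : R) : 0 < p -> p <= q -> q <= P -> 0 <= t ->
  t `^ q <= t `^ p + t `^ P.
Proof.
move=> p0 pq qP t0; have [t1|t1] := leP t 1.
  have [->|tn0] := eqVneq t 0.
    by rewrite powR0 ?addr_ge0 ?powR_ge0// gt_eqF// (lt_le_trans p0).
  apply: ler_wpDr; first exact: powR_ge0.
  by apply: ger_powR => //; rewrite lt_neqAle eq_sym tn0 t0.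
apply: ler_wpDl; first exact: powR_ge0.
by apply: ler_powR => //; exact: ltW.
Qed.

Lemma integral_interpolation D w (p q P : R) : measurable D ->
  measurable_fun D w -> 0 < p -> p <= q -> q <= P ->
  (\int[mu]_(x in D) (`|w x| `^ q)%:E <=
   \int[mu]_(x in D) (`|w x| `^ p)%:E + \int[mu]_(x in D) (`|w x| `^ P)%:E)%E.
Proof.
move=> mD mw p0 pq qP; rewrite -ge0_integralD//; try exact: measurable_abs_powR.
apply: ge0_le_integral => //; first exact: measurable_abs_powR.
  by apply: emeasurable_funD; exact: measurable_abs_powR.
by move=> x _; rewrite lee_fin powR_interpolation.
Qed.

End sobolev_limits.

Section sobolev_limits_subcritical.
Context {R : realType} (m : nat) (p : R).
Hypotheses (p1 : 1 < p) (pm : p < m.+2%:R).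
Variables (D : set 'rV[R]_m.+2) (w : 'rV[R]_m.+2 -> R)
  (h : 'I_m.+2 -> 'rV[R]_m.+2 -> R) (f : nat -> 'rV[R]_m.+2 -> R).
Hypotheses (mD : measurable D) (bD : bounded_set D).
Hypotheses (mw : measurable_fun D w) (mh : forall i, measurable_fun D (h i)).
Hypothesis wf : C1_limit D p w h f.
Local Notation mu := (@lebesgue_rV R m.+2).
Local Notation P := (sobolev_exponent m p).
Local Open Scope ereal_scope.

Let p0 : (0 < p)%R. Proof. exact: lt_trans p1. Qed.

Let P0 : (0 < P)%R. Proof. exact: sobolev_exponent_gt0. Qed.

Let Pp0 : (0 < P / p)%R. Proof. exact: divr_gt0. Qed.

(** The Sobolev inequality for w - f_k, whose gradient tends to 0 in L^p, settles the exponent P;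
    interpolation with the exponent p reaches the rest of the range. *)
Lemma C1_limit_vanishing (q : R) : (p <= q <= P)%R ->
  vanishing (fun k => \int[mu]_(x in D) (`|w x - f k x| `^ q)%:E).
Proof.
move=> /andP[pq qP]; have [tf vw vh] := wf.
have mB k : measurable_fun D (fun x => w x - f k x)%R.
  have [mf _] := measurable_C1_test (tf k).
  by apply: measurable_funB => //; exact: measurable_funTS.
apply: (@vanishing_le _ _ (fun k => \int[mu]_(x in D) (`|w x - f k x| `^ p)%:E +
    \int[mu]_(x in D) (`|w x - f k x| `^ P)%:E)).
  by move=> k; apply: integral_interpolation.
apply: vanishingD; first exact: vw.
have [C C0 HC] := sobolev_closure p1 pm.
move=> e e0; pose y : R := ((e / (C + 1)) `^ (P / p)^-1)%R.
have C1 : (0 < C + 1)%R by rewrite ltr_wpDl.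
have y0 : (0 < y)%R by apply: powR_gt0; exact: divr_gt0.
(* Dividing y by m + 3 keeps the sum of the m + 2 terms strictly below y, as [HC] demands. *)
have N0 : (0 < m.+3%:R :> R)%R by rewrite ltr0n.
have yN0 : (0 < y / m.+3%:R)%R by exact: divr_gt0.
have near_h : \forall k \near \oo, forall i, \int[mu]_(x in D)
    (`|h i x - partial i (f k) x| `^ p)%:E <= (y / m.+3%:R)%:E.
  by have := vanishing_forall vh yN0.
apply: filterS near_h => k hk.
apply: (@le_trans _ _ (C * y `^ (P / p))%:E).
  apply: HC (C1_limit_approximable (C1_limitB k wf)) _ => //.
    move=> i; have [_ mdf] := measurable_C1_test (tf k).
    by apply: measurable_funB => //; exact: measurable_funTS.
  apply: (@le_lt_trans _ _ (\sum_(i < m.+2) (y / m.+3%:R)%:E)).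
    by apply: lee_sum => i _; exact: hk.
  rewrite (_ : \sum_(i < _) _ = m.+2%:R%:E * (y / m.+3%:R)%:E); last first.
    by rewrite mule_natl sumr_const card_ord.
  rewrite -EFinM lte_fin mulrCA gtr_pMr// ltr_pdivrMr// mul1r.
  by rewrite ltr_nat.
rewrite lee_fin /y -powRrM mulVf ?gt_eqF// powRr1; last first.
  by apply: ltW; exact: divr_gt0.
by rewrite mulrCA ger_pMr// ler_pdivrMr// mul1r lerDl.
Qed.

Lemma C1_limit_lty (q : R) : (p <= q <= P)%R ->
  \int[mu]_(x in D) (`|w x| `^ p)%:E < +oo ->
  (forall i, \int[mu]_(x in D) (`|h i x| `^ p)%:E < +oo) ->
  \int[mu]_(x in D) (`|w x| `^ q)%:E < +oo.
Proof.
move=> /andP[pq qP] wp hp.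
apply: le_lt_trans (integral_interpolation mD mw p0 pq qP) _.
rewrite lte_add_pinfty//; have [C C0 HC] := sobolev_closure p1 pm.
pose Y := \sum_(i < m.+2) \int[mu]_(x in D) (`|h i x| `^ p)%:E.
have Y0 : 0 <= Y by apply: sume_ge0 => i _; exact: integral_ge0.
have Yoo : Y < +oo by apply: lte_sum_pinfty => i _; exact: hp.
have YE : Y = (fine Y)%:E by rewrite fineK ?ge0_fin_numE.
apply: le_lt_trans (HC D w h (fine Y + 1)%R mD bD mw mh
  (C1_limit_approximable wf) _) (ltry _).
by rewrite -/Y YE lte_fin ltrDl.
Qed.

(** With zero gradient the bound C y^(P/p) is available for every y > 0. This is what forbids Du = 0
    for a nontrivial u. *)
Lemma C1_limit_eq0 :
  (forall i, \int[mu]_(x in D) (`|h i x| `^ p)%:E = 0) ->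
  \int[mu]_(x in D) (`|w x| `^ P)%:E = 0.
Proof.
move=> h0; apply/eqP; rewrite eq_le integral_ge0//= andbT.
have [C C0 HC] := sobolev_closure p1 pm.
apply/lee_addgt0Pr => e e0; rewrite add0e.
pose y : R := ((e / (C + 1)) `^ (P / p)^-1)%R.
have C1 : (0 < C + 1)%R by rewrite ltr_wpDl.
have y0 : (0 < y)%R by apply: powR_gt0; exact: divr_gt0.
apply: (@le_trans _ _ (C * y `^ (P / p))%:E).
  apply: HC (C1_limit_approximable wf) _ => //.
  by rewrite big1// lte_fin.
rewrite lee_fin /y -powRrM mulVf ?gt_eqF// powRr1; last first.
  by apply: ltW; exact: divr_gt0.
by rewrite mulrCA ger_pMr// ler_pdivrMr// mul1r lerDl.
Qed.

End sobolev_limits_subcritical.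

(** * Norms over D and Hoelder's inequality for r up to infinity *)

Section Lnorm_estimates.
Context d {T : measurableType d} {R : realType}.
Variable mu : {measure set T -> \bar R}.
Local Open Scope ereal_scope.

(** For r = +oo the conjugate exponent is s = 1, and f is bounded almost everywhere by its essential
    supremum. *)
Lemma le_Lnorm_poweR (f h : T -> R) (r : \bar R) (s : R) :
  measurable_fun setT f -> measurable_fun setT h -> 0 < r -> (0 < s)%R ->
  r^-1 + (s^-1)%:E = 1 ->
  \int[mu]_x `|f x * h x|%:E <=
  'N[mu]_r[EFin \o f] * (\int[mu]_x (`|h x| `^ s)%:E) `^ s^-1.
Proof.
move=> mf mh; case: r => [r| |//].
  rewrite lte_fin => r0 s0; rewrite inver gt_eqF// -EFinD => -[rs].
  have := hoelder mu mf mh r0 s0 rs; rewrite Lnorm1 => /le_trans; apply.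
  by apply: lee_wpmul2l; [exact: Lnorm_ge0|rewrite [in leLHS]unlock].
move=> _ s0; rewrite invey add0e => -[s1].
have -> : (s = 1)%R by apply: (can_inj invrK); rewrite s1 invr1.
rewrite invr1 poweRe1; last by apply: integral_ge0.
under [X in _ <= _ * X]eq_integral do rewrite powRr1//.
(* The norm with exponent +oo is defined as 0 on a space of measure zero; the left side vanishes as
   well in that case. *)
rewrite unlock; case: ifPn => [muT|]; last first.
  rewrite -leNgt => muT; rewrite mul0e (ae_eq_integral (cst 0)) ?integral0//.
    by apply/measurable_EFinP/measurableT_comp => //; exact: measurable_funM.
  by apply: ae_eq0 => //; apply/eqP; rewrite eq_le muT /=.
have mnh : measurable_fun setT (fun x => `|h x|%:E).
  by apply/measurable_EFinP; exact: measurableT_comp.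
have S0 : 0 <= ess_sup mu (abse \o (EFin \o f)).
  by apply: ess_sup_gee => //; apply: nearW => x /=; rewrite lee_fin.
rewrite -ge0_integralZl//; apply: ae_ge0_le_integral => //.
- by apply/measurable_EFinP/measurableT_comp => //; exact: measurable_funM.
- by move=> x _; apply: mule_ge0.
- exact: measurable_funeM.
- apply: filterS (ess_sup_ge mu (abse \o (EFin \o f))) => x fx _.
  by rewrite normrM EFinM; apply: lee_wpmul2r.
Qed.

End Lnorm_estimates.

Section Lnorm_on_lemmas.
Context {R : realType} {n : nat}.
Local Notation mu := (@lebesgue_rV R n).
Variables (D : set 'rV[R]_n) (mD : measurable D).
Implicit Types f : 'rV[R]_n -> R.
Local Open Scope ereal_scope.

Lemma integral_abs_powR_restrict f (p : R) : p != 0%R ->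
  \int[mu]_x (`|(f \_ D) x| `^ p)%:E = \int[mu]_(x in D) (`|f x| `^ p)%:E.
Proof.
move=> p0; rewrite [RHS]integral_mkcond; apply: eq_integral => x _.
by rewrite !patchE; case: ifPn => //; rewrite normr0 powR0.
Qed.

Lemma Lnorm_onE f (p : R) : p != 0%R ->
  Lnorm_on D p%:E f = (\int[mu]_(x in D) (`|f x| `^ p)%:E) `^ p^-1.
Proof.
by move=> p0; rewrite /Lnorm_on unlock -integral_abs_powR_restrict.
Qed.

Lemma in_LpP f (p : R) : (0 < p)%R -> in_Lp D p%:E f ->
  measurable_fun D f /\ \int[mu]_(x in D) (`|f x| `^ p)%:E < +oo.
Proof.
move=> p0 [mf]; rewrite Lnorm_onE ?gt_eqF// => fp; split.
  exact: (measurable_restrictT f mD).2.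
by move: fp; apply: lty_poweRy; rewrite invr_neq0 ?gt_eqF.
Qed.

Lemma le_Lnorm_on_poweR f h (r : \bar R) (s : R) :
  measurable_fun D f -> measurable_fun D h -> 0 < r -> (0 < s)%R ->
  r^-1 + (s^-1)%:E = 1 ->
  \int[mu]_(x in D) `|f x * h x|%:E <=
  Lnorm_on D r f * (\int[mu]_(x in D) (`|h x| `^ s)%:E) `^ s^-1.
Proof.
move=> /(measurable_restrictT _ mD) mf /(measurable_restrictT _ mD) mh r0 s0 rs.
have := le_Lnorm_poweR mu mf mh r0 s0 rs.
rewrite integral_abs_powR_restrict ?gt_eqF//; apply: le_trans.
rewrite [leLHS]integral_mkcond le_eqVlt; apply/orP; left; apply/eqP.
by apply: eq_integral => x _; rewrite !patchE; case: ifPn; rewrite ?mul0r ?normr0.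
Qed.

Lemma Lnorm_on_cst_lty (r : \bar R) (c : R) : mu D < +oo -> 0 < r ->
  Lnorm_on D r (cst c) < +oo.
Proof.
move=> Doo; case: r => [r| |//]; rewrite ?lte_fin => r0.
  rewrite Lnorm_onE ?gt_eqF//; apply: poweR_lty.
  have -> := integral_cst mu mD (`|c| `^ r)%:E.
  by rewrite lte_mul_pinfty ?lee_fin ?powR_ge0.
rewrite /Lnorm_on unlock; case: ifPn => // _.
apply: (@le_lt_trans _ _ `|c|%:E); last exact: ltry.
apply/ess_supP; apply: nearW => x /=; rewrite patchE lee_fin.
by case: ifPn => //; rewrite normr0.
Qed.

Lemma Lnorm_onD_lty (r : \bar R) f g : 1 <= r ->
  in_Lp D r f -> in_Lp D r g -> Lnorm_on D r (fun x => f x + g x)%R < +oo.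
Proof.
move=> r1 [mf fr] [mg gr].
apply: le_lt_trans (_ : _ <= Lnorm_on D r f + Lnorm_on D r g) _.
  rewrite /Lnorm_on (_ : _ \_ D = (f \_ D) \+ (g \_ D))%R; last first.
    by apply/funext => x /=; rewrite !patchE; case: ifPn => //; rewrite addr0.
  exact: eminkowski.
exact: lte_add_pinfty.
Qed.

End Lnorm_on_lemmas.

(** * Moduli of complex numbers and vectors *)

Section complex_modulus.
Context {R : realType}.
Implicit Types z : R[i].

Lemma sqr_modulus z : modulus z ^+ 2 = complex.Re z ^+ 2 + complex.Im z ^+ 2.
Proof. by case: z => a b; rewrite /modulus /= sqr_sqrtr// addr_ge0 ?sqr_ge0. Qed.

Lemma modulus_ge0 z : 0 <= modulus z.
Proof. by case: z => a b; exact: sqrtr_ge0. Qed.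

Lemma normr_Re_le z : `|complex.Re z| <= modulus z.
Proof.
by rewrite -ler_sqr ?nnegrE ?modulus_ge0// sqr_modulus
  real_normK ?num_real// lerDl sqr_ge0.
Qed.

Lemma normr_Im_le z : `|complex.Im z| <= modulus z.
Proof.
by rewrite -ler_sqr ?nnegrE ?modulus_ge0// sqr_modulus
  real_normK ?num_real// lerDr sqr_ge0.
Qed.

Context {n : nat}.
Implicit Types v : 'rV[R[i]]_n.

Lemma sqr_vec_modulus v :
  vec_modulus v ^+ 2 = \sum_(i < n) modulus (v ord0 i) ^+ 2.
Proof. by rewrite sqr_sqrtr// sumr_ge0// => i _; exact: sqr_ge0. Qed.

Lemma vec_modulus_ge0 v : 0 <= vec_modulus v.
Proof. exact: sqrtr_ge0. Qed.

Lemma modulus_le_vec v i : modulus (v ord0 i) <= vec_modulus v.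
Proof.
rewrite -ler_sqr ?nnegrE ?modulus_ge0 ?vec_modulus_ge0// sqr_vec_modulus.
by rewrite (bigD1 i)//= lerDl sumr_ge0// => j _; exact: sqr_ge0.
Qed.

Lemma powR_sum_le (I : Type) (s : seq I) (p : R) : 0 < p ->
  exists2 C : R, 0 <= C & forall a : I -> R, (forall i, 0 <= a i) ->
    (\sum_(i <- s) a i) `^ p <= C * \sum_(i <- s) a i `^ p.
Proof.
move=> p0; elim: s => [|j s [C C0 IH]].
  by exists 0 => // a _; rewrite !big_nil mulr0 powR0// gt_eqF.
exists (2 `^ p * (1 + C)) => [|a a0]; first by rewrite mulr_ge0 ?powR_ge0 ?addr_ge0.
have S0 : 0 <= \sum_(i <- s) a i `^ p by apply: sumr_ge0 => i _; exact: powR_ge0.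
rewrite !big_cons.
apply: le_trans (powRD_le (ltW p0) (a0 j) (sumr_ge0 _ (fun i _ => a0 i))) _.
rewrite -mulrA ler_wpM2l ?powR_ge0//.
rewrite mulrDl mul1r mulrDr -addrA lerD2l addrA [X in _ <= X]addrC.
apply: le_trans (IH _ a0) _.
by rewrite lerDl addr_ge0// mulr_ge0 ?powR_ge0.
Qed.

(** Trades a modulus, which is a square root, for its square, which is a sum; the price is the
    exponent p/2. *)
Lemma powR_sqr_normr (a p : R) : (a ^+ 2) `^ (p / 2) = `|a| `^ p.
Proof.
rewrite -[a ^+ 2]real_normK ?num_real// -powR_mulrn// -powRrM.
by rewrite mulrCA mulfV ?mulr1// pnatr_eq0.
Qed.

Lemma powR_modulus_le (p : R) z : 0 < p ->
  modulus z `^ p <= 2 `^ (p / 2) *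
    (`|complex.Re z| `^ p + `|complex.Im z| `^ p).
Proof.
move=> p0; rewrite -[modulus z]ger0_norm ?modulus_ge0//.
rewrite -(powR_sqr_normr (modulus z)) -(powR_sqr_normr (complex.Re z)).
rewrite -(powR_sqr_normr (complex.Im z)) sqr_modulus.
by apply: powRD_le; rewrite ?sqr_ge0// divr_ge0 ?ltW.
Qed.

Lemma powR_vec_modulus_le (p : R) : 0 < p ->
  exists2 C : R, 0 <= C & forall v, vec_modulus v `^ p <=
    C * \sum_(i < n) (`|complex.Re (v ord0 i)| `^ p +
                      `|complex.Im (v ord0 i)| `^ p).
Proof.
move=> p0; have p2 : 0 < p / 2 by exact: divr_gt0.
have [C C0 HC] := powR_sum_le (index_enum 'I_n) p2.
exists (C * 2 `^ (p / 2)) => [|v]; first by rewrite mulr_ge0 ?powR_ge0.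
rewrite -[vec_modulus v]ger0_norm ?vec_modulus_ge0//.
rewrite -(powR_sqr_normr (vec_modulus v)).
rewrite sqr_vec_modulus; apply: le_trans (HC _ (fun i => sqr_ge0 _)) _.
rewrite -mulrA ler_wpM2l// mulr_sumr; apply: ler_sum => i _.
by rewrite powR_sqr_normr ger0_norm ?modulus_ge0// powR_modulus_le.
Qed.

End complex_modulus.

(** * The weak form and the energy identity *)

Section test_functions.
Context {R : realType} {n : nat}.
Implicit Types (D : set 'rV[R]_n) (f : 'rV[R]_n -> R).
Implicit Types (phi u : 'rV[R]_n -> R[i]) (g : 'rV[R]_n -> 'rV[R[i]]_n).
Local Notation mu := (@lebesgue_rV R n).

Lemma smooth_C1_test D (K : set 'rV[R]_n) f : smooth f -> compact K ->
  K `<=` D -> (forall x, ~ K x -> f x = 0) -> C1_test D f.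
Proof.
move=> sf cK KD f0; have [cf df] := sf [::]; split => //.
- by move=> i; have [] := sf [:: i].
- have /compact_bounded[M [_ KM]] : compact (f @` K).
    by apply: continuous_compact => //; exact: continuous_subspaceT.
  exists (`|M| + 1) => x; have [Kx|nKx] := pselect (K x).
    by apply: KM; [have := ler_norm M; lra|exists x].
  by rewrite f0// normr0 addr_ge0.
- by move=> x nDx; apply: f0 => Kx; exact/nDx/KD.
Qed.

Lemma Cc_infty_C1_test D phi : Cc_infty D phi ->
  C1_test D (fun x => complex.Re (phi x)) /\
  C1_test D (fun x => complex.Im (phi x)).
Proof.
move=> [sR sI cK KD].
have phi0 x : ~ closure [set x | phi x != 0] x -> phi x = 0.
  by move=> nx; apply: contrapT => /eqP px; apply: nx; exact: subset_closure.
by split; [apply: (smooth_C1_test sR cK KD)|apply: (smooth_C1_test sI cK KD)];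
  move=> x /phi0 ->.
Qed.

Lemma partial_bounded (K : set 'rV[R]_n) f i : continuous (partial i f) ->
  closed K -> compact K -> (forall x, ~ K x -> f x = 0) ->
  exists M : R, forall x, `|partial i f x| <= M.
Proof.
move=> cf clK cK f0.
have /compact_bounded[M [_ KM]] : compact (partial i f @` K).
  by apply: continuous_compact => //; exact: continuous_subspaceT.
exists (`|M| + 1) => x; have [Kx|nKx] := pselect (K x).
  by apply: KM; [have := ler_norm M; lra|exists x].
have f_near0 : \near x, f x = 0.
  have oK : nbhs x (~` K) by apply: open_nbhs_nbhs; split => //; exact: closed_openC.
  by apply: filterS oK => y; exact: f0.
rewrite /partial (near_eq_derive (g := cst 0))// derive_cst normr0.
by rewrite addr_ge0.
Qed.

Lemma Cc_infty_partial_bounded D phi i : Cc_infty D phi ->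
  (exists M : R, forall x, `|partial i (fun y => complex.Re (phi y)) x| <= M) /\
  (exists M : R, forall x, `|partial i (fun y => complex.Im (phi y)) x| <= M).
Proof.
move=> [sR sI cK _].
have phi0 x : ~ closure [set x | phi x != 0] x -> phi x = 0.
  by move=> nx; apply: contrapT => /eqP px; apply: nx; exact: subset_closure.
split; apply: (partial_bounded _ (@closed_closure _ _) cK).
- exact: (sR [:: i]).1.
- by move=> x /phi0 ->.
- exact: (sI [:: i]).1.
- by move=> x /phi0 ->.
Qed.

Lemma partialN f i : (forall x, derivable f x (delta_mx ord0 i)) ->
  partial i (fun x => - f x) = (fun x => - partial i f x).
Proof. by move=> df; apply/funext => x; rewrite /partial deriveN. Qed.

Lemma smoothN f : smooth f -> smooth (fun x => - f x).
Proof.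
move=> sf.
have E s : foldr partial (fun x => - f x) s = (fun x => - foldr partial f s x).
  elim: s => //= i s ->; apply: partialN => x; exact: (sf s).2.
move=> s /=; rewrite E; have [cs ds] := sf s; split => [x|i x].
  exact: (@continuousN _ _ _ (foldr partial f s) _ (cs x)).
exact: derivableN.
Qed.

(* The products in the weak form are bilinear, so that the energy identity is
   obtained by testing with complex conjugates. *)
Definition conj_test phi : 'rV[R]_n -> R[i] :=
  fun x => Complex (complex.Re (phi x)) (- complex.Im (phi x)).

Lemma Cc_infty_conj D phi : Cc_infty D phi -> Cc_infty D (conj_test phi).
Proof.
move=> [sR sI cK KD].
have E : [set x | conj_test phi x != 0] = [set x | phi x != 0].
  apply/seteqP; split => x /=; apply: contra => /eqP.
    by rewrite /conj_test => ->; rewrite eq_complex/= oppr0 !eqxx.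
  rewrite /conj_test; case: (phi x) => a b [-> /eqP]; rewrite oppr_eq0 => /eqP ->.
  by rewrite eq_complex/= !eqxx.
by split; [exact: sR|exact: smoothN|rewrite E|rewrite E].
Qed.

Lemma grad_conj_test D phi x i : Cc_infty D phi ->
  grad (conj_test phi) x ord0 i =
  Complex (partial i (fun y => complex.Re (phi y)) x)
          (- partial i (fun y => complex.Im (phi y)) x).
Proof.
move=> [_ sI _ _]; rewrite mxE /=; congr Complex.
by rewrite (partialN (i := i) (f := fun y => complex.Im (phi y))) => // y;
  exact: (sI [::]).2.
Qed.

Lemma W01p_components D (p : R) u g : measurable D -> 0 < p -> W01p D p u g ->
  [/\ measurable_fun D (fun x => complex.Re (u x)) /\
        (\int[mu]_(x in D) (`|complex.Re (u x)| `^ p)%:E < +oo)%E,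
      measurable_fun D (fun x => complex.Im (u x)) /\
        (\int[mu]_(x in D) (`|complex.Im (u x)| `^ p)%:E < +oo)%E,
      forall i, measurable_fun D (fun x => complex.Re (g x ord0 i)) /\
        (\int[mu]_(x in D) (`|complex.Re (g x ord0 i)| `^ p)%:E < +oo)%E &
      forall i, measurable_fun D (fun x => complex.Im (g x ord0 i)) /\
        (\int[mu]_(x in D) (`|complex.Im (g x ord0 i)| `^ p)%:E < +oo)%E].
Proof.
move=> mD p0 [[[uR uI] gp _] _]; split; try exact: in_LpP.
- by move=> i; have [? _] := gp i; exact: in_LpP.
- by move=> i; have [_ ?] := gp i; exact: in_LpP.
Qed.

Let measurable_sqrt : measurable_fun [set: R] (@Num.sqrt R).
Proof. by apply: continuous_measurable_fun; exact: sqrt_continuous. Qed.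

Lemma measurable_modulus D (u : 'rV[R]_n -> R[i]) :
  measurable_fun D (fun x => complex.Re (u x)) ->
  measurable_fun D (fun x => complex.Im (u x)) ->
  measurable_fun D (modulus \o u).
Proof.
move=> mR mI; rewrite (_ : _ \o _ =
    fun x => Num.sqrt (complex.Re (u x) ^+ 2 + complex.Im (u x) ^+ 2)).
  apply: measurableT_comp; first exact: measurable_sqrt.
  by apply: measurable_funD; exact: measurable_funX.
by apply/funext => x /=; case: (u x).
Qed.

Lemma measurable_vec_modulus D g :
  (forall i, measurable_fun D (fun x => complex.Re (g x ord0 i))) ->
  (forall i, measurable_fun D (fun x => complex.Im (g x ord0 i))) ->
  measurable_fun D (vec_modulus \o g).
Proof.
move=> mR mI; rewrite /comp /vec_modulus.
apply: (measurableT_comp measurable_sqrt).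
by apply: measurable_sum => i; apply: measurable_funX; exact: measurable_modulus.
Qed.

(** Real and imaginary parts of each component are bounded by the modulus, so convergence in W^{1,p}
    passes to them. A single sequence serves both parts, since it is later inserted into the
    equation. *)
Lemma W01p_limits D (p : R) u g : measurable D -> 1 < p -> W01p D p u g ->
  exists phi : nat -> 'rV[R]_n -> R[i], [/\ forall k, Cc_infty D (phi k),
    C1_limit D p (fun x => complex.Re (u x))
      (fun i x => complex.Re (g x ord0 i)) (fun k x => complex.Re (phi k x)) &
    C1_limit D p (fun x => complex.Im (u x))
      (fun i x => complex.Im (g x ord0 i)) (fun k x => complex.Im (phi k x))].
Proof.
move=> mD p1 W; have p0 : 0 < p by exact: lt_trans p1.
have [[muR _] [muI _] mgR mgI] := W01p_components mD p0 W.
have [_ [phi Cphi cphi]] := W.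
exists phi; have vphi := cvg0_vanishing cphi.
have tphi k := Cc_infty_C1_test (Cphi k).
have mphi k := (measurable_C1_test (tphi k).1, measurable_C1_test (tphi k).2).
pose du k x := u x - phi k x; pose dg k x := g x - grad (phi k) x.
have ReB (z z' : R[i]) : complex.Re (z - z') = complex.Re z - complex.Re z'.
  by case: z z' => a b [c e].
have ImB (z z' : R[i]) : complex.Im (z - z') = complex.Im z - complex.Im z'.
  by case: z z' => a b [c e].
have mdu k : measurable_fun D (modulus \o du k).
  apply: measurable_modulus.
  - under eq_fun do rewrite ReB; apply: measurable_funB => //.
    exact: (measurable_funTS (mphi k).1.1).
  - under eq_fun do rewrite ImB; apply: measurable_funB => //.
    exact: (measurable_funTS (mphi k).2.1).
have RegE k i x : complex.Re (dg k x ord0 i) =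
    complex.Re (g x ord0 i) - partial i (fun y => complex.Re (phi k y)) x.
  by rewrite /dg !mxE ReB.
have ImgE k i x : complex.Im (dg k x ord0 i) =
    complex.Im (g x ord0 i) - partial i (fun y => complex.Im (phi k y)) x.
  by rewrite /dg !mxE ImB.
have mdg k : measurable_fun D (vec_modulus \o dg k).
  apply: measurable_vec_modulus => i.
  - under eq_fun do rewrite RegE; apply: measurable_funB; first exact: (mgR i).1.
    exact: (measurable_funTS ((mphi k).1.2 i)).
  - under eq_fun do rewrite ImgE; apply: measurable_funB; first exact: (mgI i).1.
    exact: (measurable_funTS ((mphi k).2.2 i)).
have vu : vanishing (fun k =>
    \int[mu]_(x in D) (`|(modulus \o du k) x| `^ p)%:E)%E.
  apply: (@vanishing_le _ _ (fun k =>
      (norm_W1p D p (du k) (dg k)) `^ p)%E); last first.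
    by apply: vanishing_poweR => // k; rewrite adde_ge0 ?Lnorm_ge0.
  move=> k; rewrite -[leLHS]poweRe1; last by exact: integral_ge0.
  rewrite -(mulVf (lt0r_neq0 p0)) poweRrM -Lnorm_onE ?gt_eqF//.
  by apply: ge0_le_poweR; rewrite ?Lnorm_ge0 ?(ltW p0)// leeDl// Lnorm_ge0.
have vg : vanishing (fun k =>
    \int[mu]_(x in D) (`|(vec_modulus \o dg k) x| `^ p)%:E)%E.
  apply: (@vanishing_le _ _ (fun k =>
      (norm_W1p D p (du k) (dg k)) `^ p)%E); last first.
    by apply: vanishing_poweR => // k; rewrite adde_ge0 ?Lnorm_ge0.
  move=> k; rewrite -[leLHS]poweRe1; last by exact: integral_ge0.
  rewrite -(mulVf (lt0r_neq0 p0)) poweRrM -Lnorm_onE ?gt_eqF//.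
  by apply: ge0_le_poweR; rewrite ?Lnorm_ge0 ?(ltW p0)// leeDr// Lnorm_ge0.
have mono (f1 f2 : 'rV[R]_n -> R) : measurable_fun D f1 -> measurable_fun D f2 ->
    (forall x, `|f1 x| <= f2 x) -> (\int[mu]_(x in D) (`|f1 x| `^ p)%:E <=
      \int[mu]_(x in D) (`|f2 x| `^ p)%:E)%E.
  move=> m1 m2 f12; apply: ge0_le_integral => //; try exact: measurable_abs_powR.
  move=> x _; rewrite lee_fin ge0_ler_powR ?nnegrE ?(ltW p0)//.
  exact: le_trans (f12 x) (ler_norm _).
split; [exact: Cphi|split|split].
- by move=> k; have [] := tphi k.
- apply: vanishing_le vu => k; apply: mono => //.
    by apply: measurable_funB => //; exact: (measurable_funTS (mphi k).1.1).
  by move=> x; rewrite -ReB; exact: normr_Re_le.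
- move=> i; apply: vanishing_le vg => k; apply: mono => //.
    apply: measurable_funB; first exact: (mgR i).1.
    exact: (measurable_funTS ((mphi k).1.2 i)).
  by move=> x; rewrite -RegE (le_trans (normr_Re_le _))// modulus_le_vec.
- by move=> k; have [] := tphi k.
- apply: vanishing_le vu => k; apply: mono => //.
    by apply: measurable_funB => //; exact: (measurable_funTS (mphi k).2.1).
  by move=> x; rewrite -ImB; exact: normr_Im_le.
- move=> i; apply: vanishing_le vg => k; apply: mono => //.
    apply: measurable_funB; first exact: (mgI i).1.
    exact: (measurable_funTS ((mphi k).2.2 i)).
  by move=> x; rewrite -ImgE (le_trans (normr_Im_le _))// modulus_le_vec.
Qed.

End test_functions.

(** * Exponents, and Hoelder bounds for the weights in the equation *)

Section weak_form.
Context {R : realType}.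

(** All of it is read off p/q = 1 - 1/r, which lies between 1 - p/N > 0 and 1 because r > N/p. *)
Lemma exponent_range (N p q : R) (r : \bar R) : 1 < p -> p < N ->
  ((N / p)%:E < r)%E -> (r^-1 + (p / q)%:E = 1)%E ->
  [/\ (1 <= r)%E, 0 < q & p <= q <= N * p / (N - p)].
Proof.
move=> p1 pN rN rq; have p0 : 0 < p by exact: lt_trans p1.
have N0 : 0 < N by exact: lt_trans pN.
have Np : 0 < N - p by rewrite subr_gt0.
have Np1 : 1 < N / p by rewrite ltr_pdivlMr// mul1r.
have [r1 t1 tN] : [/\ (1 <= r)%E, p / q <= 1 & 1 - p / N <= p / q].
  case: r rN rq => [r| |//].
    rewrite lte_fin => rN; have r0 : 0 < r by apply: lt_trans rN; exact: divr_gt0.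
    rewrite inver gt_eqF// -EFinD => -[rq]; split.
    - by rewrite lee_fin ltW// (lt_trans Np1).
    - by rewrite -rq lerDr invr_ge0 ltW.
    - have : r^-1 <= p / N.
        by rewrite -[p / N]invf_div lef_pV2 ?posrE ?divr_gt0// ltW.
      by move: rq; set t := p / q; lra.
  move=> _; rewrite invey add0e => -[->]; split; [exact: leey|exact: lexx|].
  by rewrite lerBlDr lerDl divr_ge0 ?ltW.
have t0 : 0 < p / q.
  by apply: lt_le_trans tN; rewrite subr_gt0 ltr_pdivrMr// mul1r.
have q0 : 0 < q by move: t0; rewrite pmulr_rgt0// invr_gt0.
split => //; apply/andP; split.
  by move: t1; rewrite ler_pdivrMr// mul1r.
rewrite ler_pdivlMr// mulrC; move: tN; rewrite ler_pdivlMr//.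
move=> /(ler_wpM2l (ltW N0)); apply: le_trans; rewrite mulrA ler_pM2r//.
by rewrite mulrBr mulr1 mulrCA mulfV ?gt_eqF// mulr1.
Qed.

(** At a = 0 both sides vanish, whatever the power with exponent p - 2 is there: the convention that
    |u|^(p-2) u is 0 where u = 0. *)
Lemma powR_mul (a p : R) : 1 < p -> 0 <= a -> a `^ (p - 2) * a = a `^ (p - 1).
Proof.
move=> p1; rewrite le_eqVlt => /predU1P[<-|a0].
  by rewrite mulr0 powR0// subr_eq0 gt_eqF.
rewrite (_ : p - 1 = (p - 2) + 1); last by lra.
by rewrite [RHS]powRD ?(powRr1 (ltW a0))// (gt_eqF a0)/= implybT.
Qed.

Lemma powR_mul_sqr (a p : R) : 1 < p -> 0 <= a -> a `^ (p - 2) * a ^+ 2 = a `^ p.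
Proof.
move=> p1 a0; rewrite expr2 mulrA powR_mul//.
move: a0; rewrite le_eqVlt => /predU1P[<-|a0].
  by rewrite mulr0 powR0// gt_eqF// (lt_trans _ p1).
rewrite [in RHS](_ : p = (p - 1) + 1); last by rewrite subrK.
by rewrite [RHS]powRD ?(powRr1 (ltW a0))// (gt_eqF a0)/= implybT.
Qed.

Section bounds.
Context {n : nat}.
Local Notation mu := (@lebesgue_rV R n).
Variables (D : set 'rV[R]_n) (mD : measurable D).
Implicit Types (A U W G H : 'rV[R]_n -> R).
Local Open Scope ereal_scope.

(** Raised to the power q/p, the product splits into |H|^(q/p) and U^(q (1 - 1/p)), to which Hoelder
    applies with weights 1/p and 1 - 1/p. *)
Let hoelder_pair (p q : R) U H : (1 < p)%R -> (0 < q)%R ->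
  measurable_fun D U -> measurable_fun D H -> (forall x, 0 <= U x)%R ->
  \int[mu]_(x in D) (`|U x `^ (p - 1) * H x| `^ (q / p))%:E <=
  (\int[mu]_(x in D) (`|H x| `^ q)%:E) `^ p^-1 *
  (\int[mu]_(x in D) (`|U x| `^ q)%:E) `^ (1 - p^-1).
Proof.
move=> p1 q0 mU mH U0; have p0 : (0 < p)%R by exact: lt_trans p1.
have t01 : (0 < p^-1 < 1)%R by rewrite invr_gt0 p0 invf_lt1.
apply: le_trans (hoelder_weights_on mu mD t01 (measurable_abs_powR q mH)
  (measurable_abs_powR q mU) (fun _ _ => powR_ge0 _ _) (fun _ _ => powR_ge0 _ _)).
rewrite le_eqVlt; apply/orP; left; apply/eqP; apply: eq_integral => x _.
rewrite !poweR_EFin -EFinM; congr EFin.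
rewrite normrM (ger0_norm (powR_ge0 _ _)) (ger0_norm (U0 x)) powRM ?powR_ge0//.
have pE : ((p - 1) * (q / p) = q * (1 - p^-1))%R by field; rewrite gt_eqF.
by rewrite -!powRrM pE; exact: mulrC.
Qed.

(** The case q = p of [hoelder_pair]; K is the (p-1)-th power of the L^p norm of A. *)
Lemma gradient_weight_bound (p : R) A G : (1 < p)%R ->
  measurable_fun D A -> measurable_fun D G ->
  (forall x, 0 <= A x)%R -> (forall x, `|G x| <= A x `^ (p - 1))%R ->
  \int[mu]_(x in D) (`|A x| `^ p)%:E < +oo ->
  exists2 K : R, (0 <= K)%R & forall H, measurable_fun D H ->
    \int[mu]_(x in D) `|G x * H x|%:E <=
    K%:E * (\int[mu]_(x in D) (`|H x| `^ p)%:E) `^ p^-1.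
Proof.
move=> p1 mA mG A0 GA Aoo; have p0 : (0 < p)%R by exact: lt_trans p1.
set X := (\int[mu]_(x in D) (`|A x| `^ p)%:E) `^ (1 - p^-1).
have X0 : 0 <= X by exact: poweR_ge0.
have XE : (fine X)%:E = X by rewrite fineK// ge0_fin_numE// poweR_lty.
exists (fine X) => [|H mH]; first exact: fine_ge0.
rewrite XE muleC; apply: le_trans (hoelder_pair p1 p0 mA mH A0).
have mpA : measurable_fun D (fun x => (A x `^ (p - 1))%R).
  by apply: (measurableT_comp (measurable_powR _)).
apply: ge0_le_integral => //.
- by apply/measurable_EFinP/measurableT_comp => //; exact: measurable_funM.
- by apply: measurable_abs_powR; exact: measurable_funM.
move=> x _; rewrite mulfV ?gt_eqF// powRr1// lee_fin !normrM.
by rewrite ler_wpM2r// (ger0_norm (powR_ge0 _ _)).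
Qed.

(** Hoelder for three factors in two steps: W in L^r against U^(p-1) H in L^(q/p), conjugate by the
    relation between r and q, and then [hoelder_pair]. [X] is the (p-1)-th power of the L^q norm of
    U. *)
Lemma potential_weight_bound (p q : R) (r : \bar R) U W G : (1 < p)%R ->
  (0 < q)%R -> 1 <= r -> r^-1 + (p / q)%:E = 1 ->
  measurable_fun D U -> measurable_fun D W -> measurable_fun D G ->
  (forall x, 0 <= U x)%R ->
  (forall x, `|G x| <= `|W x| * U x `^ (p - 1))%R ->
  \int[mu]_(x in D) (`|U x| `^ q)%:E < +oo -> Lnorm_on D r W < +oo ->
  exists2 K : R, (0 <= K)%R & forall H, measurable_fun D H ->
    \int[mu]_(x in D) `|G x * H x|%:E <=
    K%:E * (\int[mu]_(x in D) (`|H x| `^ q)%:E) `^ q^-1.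
Proof.
move=> p1 q0 r1 rq mU mW mG U0 GW Uoo Woo; have p0 : (0 < p)%R by exact: lt_trans p1.
have r0 : 0 < r by exact: lt_le_trans r1.
have s0 : (0 < q / p)%R by exact: divr_gt0.
set X := (\int[mu]_(x in D) (`|U x| `^ q)%:E) `^ ((1 - p^-1) * (p / q)).
have X0 : 0 <= X by exact: poweR_ge0.
have XE : (fine X)%:E = X by rewrite fineK// ge0_fin_numE// poweR_lty.
have W0 : 0 <= Lnorm_on D r W by exact: Lnorm_ge0.
have WE : (fine (Lnorm_on D r W))%:E = Lnorm_on D r W by rewrite fineK// ge0_fin_numE.
exists (fine (Lnorm_on D r W) * fine X)%R => [|H mH].
  by apply: mulr_ge0; exact: fine_ge0.
have mpU : measurable_fun D (fun x => (U x `^ (p - 1))%R).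
  by apply: (measurableT_comp (measurable_powR _)).
have mUH : measurable_fun D (fun x => U x `^ (p - 1) * H x)%R by exact: measurable_funM.
rewrite EFinM WE XE -muleA.
apply: (@le_trans _ _ (\int[mu]_(x in D) `|W x * (U x `^ (p - 1) * H x)|%:E)).
  apply: ge0_le_integral => //.
  - by apply/measurable_EFinP/measurableT_comp => //; exact: measurable_funM.
  - by apply/measurable_EFinP/measurableT_comp => //; exact: measurable_funM.
  move=> x _; rewrite lee_fin !normrM mulrA ler_wpM2r//.
  by rewrite (ger0_norm (powR_ge0 _ _)).
have rs : r^-1 + ((q / p)^-1)%:E = 1 by rewrite invf_div.
apply: le_trans (le_Lnorm_on_poweR mD mW mUH r0 s0 rs) _.
apply: lee_wpmul2l => //; rewrite invf_div.
have pq0 : (0 <= p / q)%R by rewrite divr_ge0 ?ltW.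
apply: le_trans (ge0_le_poweR pq0 _ (hoelder_pair p1 q0 mU mH U0)) _.
  exact: integral_ge0.
rewrite poweRM ?poweR_ge0// -!poweRrM muleC; apply: lee_wpmul2l => //.
by rewrite mulrA mulVf ?gt_eqF// mul1r.
Qed.

End bounds.

End weak_form.

Section finite_sums.
Context d {T : measurableType d} {R : realType}.
Variables (mu : {measure set T -> \bar R}) (D : set T) (mD : measurable D).

Lemma integrable_addr (f1 f2 : T -> R) : mu.-integrable D (EFin \o f1) ->
  mu.-integrable D (EFin \o f2) ->
  mu.-integrable D (EFin \o (fun x => f1 x + f2 x)).
Proof. by move=> i1 i2; have := integrableD mD i1 i2. Qed.

Lemma Rintegral_sum n (f : 'I_n -> T -> R) :
  (forall i, mu.-integrable D (EFin \o f i)) ->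
  \int[mu]_(x in D) (\sum_(i < n) f i x) = \sum_(i < n) \int[mu]_(x in D) f i x.
Proof.
move=> fi; rewrite /Rintegral sum_fine; last first.
  by move=> i _; exact: (integrable_fin_num mD (fi i)).
congr fine; rewrite -integral_sum//.
by apply: eq_integral => x _; rewrite -sumEFin.
Qed.

Lemma cvg_sumr n (a : 'I_n -> nat -> R) (l : 'I_n -> R) :
  (forall i, a i k @[k --> \oo] --> l i) ->
  (\sum_(i < n) a i k) @[k --> \oo] --> \sum_(i < n) l i.
Proof.
move=> al; elim: (index_enum _) => [|i s IH].
  by under eq_fun do rewrite big_nil; rewrite big_nil; exact: cvg_cst.
by under eq_fun do rewrite big_cons; rewrite big_cons; exact: cvgD.
Qed.

End finite_sums.

(** * Passing to the limit in the equation *)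

Section energy_identity.
Context {R : realType} (m : nat).
Local Notation mu := (@lebesgue_rV R m.+2).
Variables (D : set 'rV[R]_m.+2) (p q : R) (r : \bar R).
Variables (V : 'rV[R]_m.+2 -> R) (E : R).
Variables (u : 'rV[R]_m.+2 -> R[i]) (g : 'rV[R]_m.+2 -> 'rV[R[i]]_m.+2).
Hypotheses (mD : measurable D) (bD : bounded_set D).
Hypotheses (p1 : 1 < p) (pm : p < m.+2%:R).
Hypotheses (r1 : (1 <= r)%E) (rq : (r^-1 + (p / q)%:E = 1)%E).
Hypotheses (q0 : 0 < q) (pqP : p <= q <= sobolev_exponent m p).
Hypothesis (VL : in_Lp D r V).
Hypothesis (W : W01p D p u g).

Let U x := modulus (u x).
Let A x := vec_modulus (g x).

Let p0 : 0 < p. Proof. exact: lt_trans p1. Qed.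

Let muR : measurable_fun D (fun x => complex.Re (u x)).
Proof. by have [[]] := W01p_components mD p0 W. Qed.

Let muI : measurable_fun D (fun x => complex.Im (u x)).
Proof. by have [_ []] := W01p_components mD p0 W. Qed.

Let mgR i : measurable_fun D (fun x => complex.Re (g x ord0 i)).
Proof. by have [_ _ /(_ i)[]] := W01p_components mD p0 W. Qed.

Let mgI i : measurable_fun D (fun x => complex.Im (g x ord0 i)).
Proof. by have [_ _ _ /(_ i)[]] := W01p_components mD p0 W. Qed.

Lemma measurable_W01p_modulus : measurable_fun D U.
Proof. exact: measurable_modulus. Qed.

Lemma measurable_W01p_gradient : measurable_fun D A.
Proof. exact: measurable_vec_modulus. Qed.

Let integral_add_lty (f1 f2 : 'rV[R]_m.+2 -> R) (s : R) :
  measurable_fun D f1 -> measurable_fun D f2 ->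
  (\int[mu]_(x in D) (`|f1 x| `^ s)%:E < +oo)%E ->
  (\int[mu]_(x in D) (`|f2 x| `^ s)%:E < +oo)%E ->
  (\int[mu]_(x in D) (`|f1 x| `^ s + `|f2 x| `^ s)%:E < +oo)%E.
Proof.
move=> m1 m2 i1 i2; under eq_integral do rewrite EFinD.
rewrite ge0_integralD//; try exact: measurable_abs_powR.
exact: (lte_add_pinfty i1 i2).
Qed.

Let measurable_add_powR (f1 f2 : 'rV[R]_m.+2 -> R) (s : R) :
  measurable_fun D f1 -> measurable_fun D f2 ->
  measurable_fun D (fun x => (`|f1 x| `^ s + `|f2 x| `^ s)%:E).
Proof.
move=> m1 m2; under eq_fun do rewrite EFinD.
by apply: emeasurable_funD; exact: measurable_abs_powR.
Qed.

Lemma W01p_modulus_lty : (\int[mu]_(x in D) (`|U x| `^ q)%:E < +oo)%E.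
Proof.
have [[_ uR] [_ uI] gR gI] := W01p_components mD p0 W.
have [phi [_ cR cI]] := W01p_limits mD p1 W.
have uRq := C1_limit_lty p1 pm mD bD muR mgR cR pqP uR (fun i => (gR i).2).
have uIq := C1_limit_lty p1 pm mD bD muI mgI cI pqP uI (fun i => (gI i).2).
apply: (@le_lt_trans _ _ (\int[mu]_(x in D) ((2 `^ (q / 2))%:E *
    (`|complex.Re (u x)| `^ q + `|complex.Im (u x)| `^ q)%:E))%E).
  apply: ge0_le_integral => //.
  - by apply: measurable_abs_powR; exact: measurable_W01p_modulus.
  - by apply: measurable_funeM; exact: measurable_add_powR.
  - move=> x _; rewrite -EFinM lee_fin ger0_norm ?modulus_ge0//.
    exact: powR_modulus_le.
rewrite ge0_integralZl//; last exact: measurable_add_powR.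
apply: lte_mul_pinfty; rewrite ?lee_fin ?powR_ge0//.
exact: (integral_add_lty muR muI uRq uIq).
Qed.

Lemma W01p_gradient_lty : (\int[mu]_(x in D) (`|A x| `^ p)%:E < +oo)%E.
Proof.
have [_ _ gR gI] := W01p_components mD p0 W.
have [C C0 HC] := @powR_vec_modulus_le R m.+2 _ p0.
pose h i x := (`|complex.Re (g x ord0 i)| `^ p + `|complex.Im (g x ord0 i)| `^ p)%:E.
have mh i : measurable_fun D (h i) by exact: measurable_add_powR.
have h0 i x : D x -> (0 <= h i x)%E by move=> _; rewrite lee_fin addr_ge0 ?powR_ge0.
have mS : measurable_fun D (fun x => \sum_(i < m.+2) h i x)%E by exact: emeasurable_sum.
apply: (@le_lt_trans _ _ (\int[mu]_(x in D) (C%:E * \sum_(i < m.+2) h i x))%E).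
  apply: ge0_le_integral => //.
  - by apply: measurable_abs_powR; exact: measurable_W01p_gradient.
  - exact: measurable_funeM.
  - move=> x _; rewrite sumEFin -EFinM lee_fin ger0_norm ?vec_modulus_ge0//.
    exact: HC.
rewrite ge0_integralZl//; last by move=> x Dx; apply: sume_ge0 => i _; exact: h0.
apply: lte_mul_pinfty; rewrite ?lee_fin//.
rewrite ge0_integral_sum//; apply: lte_sum_pinfty => i _.
exact: (integral_add_lty (gR i).1 (gI i).1 (gR i).2 (gI i).2).
Qed.

Let ReM (z z' : R[i]) : complex.Re (z * z') =
  complex.Re z * complex.Re z' - complex.Im z * complex.Im z'.
Proof. by case: z z' => a b [a' b']. Qed.

Let ReCM (c : R) (z : R[i]) : complex.Re (c%:C%C * z) = c * complex.Re z.
Proof. by rewrite ReM /= mul0r subr0. Qed.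

(** Conjugation makes the bilinear product Hermitian. Its real part is the Euclidean product of the
    real and imaginary components, so the pairing splits into real ones. *)
Let Re_dotc_conj (v : 'rV[R[i]]_m.+2) phi x : Cc_infty D phi ->
  complex.Re (dotc v (grad (conj_test phi) x)) =
  \sum_(i < m.+2) (complex.Re (v ord0 i) * partial i (fun y => complex.Re (phi y)) x
                  + complex.Im (v ord0 i) * partial i (fun y => complex.Im (phi y)) x).
Proof.
move=> Cphi; rewrite /dotc (big_morph (@complex.Re R) (id1 := 0) (op1 := +%R))//.
  apply: eq_bigr => i _; rewrite (grad_conj_test x i Cphi) ReM /=.
  by rewrite mulrN opprK.
by move=> [a b] [a' b'].
Qed.

Section pairing_limits.
Variable phi : nat -> 'rV[R]_m.+2 -> R[i].
Hypothesis Cphi : forall k, Cc_infty D (phi k).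
Hypothesis cR : C1_limit D p (fun x => complex.Re (u x))
  (fun i x => complex.Re (g x ord0 i)) (fun k x => complex.Re (phi k x)).
Hypothesis cI : C1_limit D p (fun x => complex.Im (u x))
  (fun i x => complex.Im (g x ord0 i)) (fun k x => complex.Im (phi k x)).

(** The components of the fixed weight |Du|^(p-2) Du are at most |Du|^(p-1), so convergence of the
    gradients in L^p suffices. The limit is real, and only real parts are followed. *)
Lemma gradient_pairing_limit :
  complex.Re (Cintegral D (fun x => (vec_modulus (g x) `^ (p - 2))%:C%C *
    dotc (g x) (grad (conj_test (phi k)) x))) @[k --> \oo] -->
  \int[mu]_(x in D) (A x `^ p).
Proof.
have [_ _ gR gI] := W01p_components mD p0 W.
pose G x := A x `^ (p - 2).
pose a i x := complex.Re (g x ord0 i); pose b i x := complex.Im (g x ord0 i).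
pose da i k := partial i (fun y => complex.Re (phi k y)).
pose db i k := partial i (fun y => complex.Im (phi k y)).
have mA := measurable_W01p_gradient.
have mG : measurable_fun D G by apply: (measurableT_comp (measurable_powR _)).
have A0 x : 0 <= A x by exact: vec_modulus_ge0.
have pair (h : 'rV[R]_m.+2 -> R) (dh : nat -> 'rV[R]_m.+2 -> R) :
    measurable_fun D h -> (\int[mu]_(x in D) (`|h x| `^ p)%:E < +oo)%E ->
    (forall x, `|h x| <= A x) -> (forall k, measurable_fun setT (dh k)) ->
    (forall k, exists M : R, forall x, `|dh k x| <= M) ->
    vanishing (fun k => \int[mu]_(x in D) (`|h x - dh k x| `^ p)%:E)%E ->
    [/\ mu.-integrable D (EFin \o (fun x => (G x * h x) * h x)),
      forall k, mu.-integrable D (EFin \o (fun x => (G x * h x) * dh k x)) &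
      \int[mu]_(x in D) ((G x * h x) * dh k x) @[k --> \oo] -->
      \int[mu]_(x in D) ((G x * h x) * h x)].
  move=> mh hp hA mdh dhM vh.
  have mGh : measurable_fun D (fun x => G x * h x) by exact: measurable_funM.
  have Gh x : `|G x * h x| <= A x `^ (p - 1).
    by rewrite normrM (ger0_norm (powR_ge0 _ _)) -powR_mul// ler_wpM2l ?powR_ge0.
  have [K K0 HK] := gradient_weight_bound mD p1 mA mGh A0 Gh W01p_gradient_lty.
  have mdhD k : measurable_fun D (dh k) by exact: (measurable_funTS (mdh k)).
  apply: (pairing_cvg mD p0 K0 mGh mh mdhD HK hp _ vh) => k.
  have [M kM] := dhM k.
  exact: (bounded_powR_lty mD bD (mdhD k) (ltW p0) kM).
have ha i x : `|a i x| <= A x.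
  exact: le_trans (normr_Re_le _) (modulus_le_vec _ _).
have hb i x : `|b i x| <= A x.
  exact: le_trans (normr_Im_le _) (modulus_le_vec _ _).
have tphi k := Cc_infty_C1_test (Cphi k).
have pa i := pair (a i) (da i) (mgR i) (gR i).2 (ha i)
  (fun k => (measurable_C1_test (tphi k).1).2 i)
  (fun k => (Cc_infty_partial_bounded i (Cphi k)).1)
  (let: And3 _ _ vg := cR in vg i).
have pb i := pair (b i) (db i) (mgI i) (gI i).2 (hb i)
  (fun k => (measurable_C1_test (tphi k).2).2 i)
  (fun k => (Cc_infty_partial_bounded i (Cphi k)).2)
  (let: And3 _ _ vg := cI in vg i).
pose S k := \sum_(i < m.+2) (\int[mu]_(x in D) ((G x * a i x) * da i k x) +
                            \int[mu]_(x in D) ((G x * b i x) * db i k x)).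
have -> : (fun k => complex.Re (Cintegral D (fun x =>
    (vec_modulus (g x) `^ (p - 2))%:C%C *
    dotc (g x) (grad (conj_test (phi k)) x)))) = S.
  apply/funext => k; rewrite /= /S.
  under [RHS]eq_bigr => i _.
    have [_ /(_ k) ia _] := pa i; have [_ /(_ k) ib _] := pb i.
    rewrite -RintegralD//; over.
  rewrite -Rintegral_sum//; last first.
    move=> i; have [_ /(_ k) ia _] := pa i; have [_ /(_ k) ib _] := pb i.
    exact: integrable_addr.
  apply: eq_Rintegral => x _; rewrite ReCM Re_dotc_conj// mulr_sumr.
  by apply: eq_bigr => i _; rewrite mulrDr !mulrA.
have -> : \int[mu]_(x in D) (A x `^ p) =
    \sum_(i < m.+2) (\int[mu]_(x in D) ((G x * a i x) * a i x) +
                     \int[mu]_(x in D) ((G x * b i x) * b i x)).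
  under [RHS]eq_bigr => i _.
    have [ia _ _] := pa i; have [ib _ _] := pb i.
    rewrite -RintegralD//; over.
  rewrite -Rintegral_sum//; last first.
    by move=> i; have [ia _ _] := pa i; have [ib _ _] := pb i; exact: integrable_addr.
  apply: eq_Rintegral => x _; rewrite -(powR_mul_sqr p1 (A0 x)) sqr_vec_modulus.
  rewrite mulr_sumr; apply: eq_bigr => i _.
  by rewrite sqr_modulus mulrDr !expr2 !mulrA.
apply: cvg_sumr => i; have [_ _ la] := pa i; have [_ _ lb] := pb i.
exact: cvgD la lb.
Qed.

(** The weight is controlled only by |V + E| |u|^(p-1), so the test functions must converge in L^q.
    Integrability of the limit is kept for the later passage to the positive part. *)
Lemma potential_pairing_limit :
  mu.-integrable D (EFin \o (fun x => (V x + E) * U x `^ p)) /\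
  complex.Re (Cintegral D (fun x =>
    ((V x + E) * modulus (u x) `^ (p - 2))%:C%C * u x * conj_test (phi k) x))
    @[k --> \oo] --> \int[mu]_(x in D) ((V x + E) * U x `^ p).
Proof.
have [[_ uR] [_ uI] gR gI] := W01p_components mD p0 W.
have mU := measurable_W01p_modulus.
have U0 x : 0 <= U x by exact: modulus_ge0.
have r0 : (0 < r)%E by exact: lt_le_trans r1.
have mV : measurable_fun D V by exact: (measurable_restrictT V mD).2 VL.1.
have mVE : measurable_fun D (fun x => V x + E) by exact: measurable_funD.
(* The constant E belongs to L^r(D) because D has finite measure. *)
have VEoo : (Lnorm_on D r (fun x => V x + E)%R < +oo)%E.
  apply: (Lnorm_onD_lty (g := cst E)) => //; split.
    exact: (measurable_restrictT (cst E) mD).1 (measurable_cst _).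
  by apply: Lnorm_on_cst_lty => //; exact: bounded_lebesgue_rV.
pose G x := (V x + E) * U x `^ (p - 2).
have mG : measurable_fun D G.
  by apply: measurable_funM => //; apply: (measurableT_comp (measurable_powR _)).
have pair (h : 'rV[R]_m.+2 -> R) (fh : nat -> 'rV[R]_m.+2 -> R) :
    measurable_fun D h -> (\int[mu]_(x in D) (`|h x| `^ q)%:E < +oo)%E ->
    (forall x, `|h x| <= U x) -> (forall k, C1_test D (fh k)) ->
    vanishing (fun k => \int[mu]_(x in D) (`|h x - fh k x| `^ q)%:E)%E ->
    [/\ mu.-integrable D (EFin \o (fun x => (G x * h x) * h x)),
      forall k, mu.-integrable D (EFin \o (fun x => (G x * h x) * fh k x)) &
      \int[mu]_(x in D) ((G x * h x) * fh k x) @[k --> \oo] -->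
      \int[mu]_(x in D) ((G x * h x) * h x)].
  move=> mh hq hU tfh vh.
  have mGh : measurable_fun D (fun x => G x * h x) by exact: measurable_funM.
  have Gh x : `|G x * h x| <= `|V x + E| * U x `^ (p - 1).
    rewrite !normrM (ger0_norm (powR_ge0 _ _)) -mulrA ler_wpM2l//.
    by rewrite -powR_mul// ler_wpM2l ?powR_ge0.
  have [K K0 HK] := potential_weight_bound mD p1 q0 r1 rq mU mVE mGh U0 Gh
    W01p_modulus_lty VEoo.
  have mfh k : measurable_fun D (fh k).
    exact: (measurable_funTS (measurable_C1_test (tfh k)).1).
  apply: (pairing_cvg mD q0 K0 mGh mh mfh HK hq _ vh) => k.
  have [_ _ _ [M kM] _] := tfh k.
  exact: (bounded_powR_lty mD bD (mfh k) (ltW q0) kM).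
pose a x := complex.Re (u x); pose b x := complex.Im (u x).
have tphi k := Cc_infty_C1_test (Cphi k).
have [ia iak la] := pair a (fun k x => complex.Re (phi k x)) muR
  (C1_limit_lty p1 pm mD bD muR mgR cR pqP uR (fun i => (gR i).2))
  (fun x => normr_Re_le _) (fun k => (tphi k).1)
  (C1_limit_vanishing p1 pm mD bD muR mgR cR pqP).
have [ib ibk lb] := pair b (fun k x => complex.Im (phi k x)) muI
  (C1_limit_lty p1 pm mD bD muI mgI cI pqP uI (fun i => (gI i).2))
  (fun x => normr_Im_le _) (fun k => (tphi k).2)
  (C1_limit_vanishing p1 pm mD bD muI mgI cI pqP).
have VU x : (V x + E) * U x `^ p = (G x * a x) * a x + (G x * b x) * b x.
  rewrite -(powR_mul_sqr p1 (U0 x)) sqr_modulus mulrA mulrDr !expr2.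
  by rewrite !mulrA.
split.
  rewrite (_ : _ \o _ = EFin \o (fun x => (G x * a x) * a x + (G x * b x) * b x)).
    exact: integrable_addr.
  by apply/funext => x /=; rewrite VU.
under [X in _ --> X]eq_Rintegral => x _ do rewrite VU.
rewrite RintegralD//.
pose S k := \int[mu]_(x in D) ((G x * a x) * complex.Re (phi k x)) +
            \int[mu]_(x in D) ((G x * b x) * complex.Im (phi k x)).
have -> : (fun k => complex.Re (Cintegral D (fun x =>
    ((V x + E) * modulus (u x) `^ (p - 2))%:C%C * u x * conj_test (phi k) x))) = S.
  apply/funext => k; rewrite /= /S -RintegralD//.
  apply: eq_Rintegral => x _; rewrite -mulrA ReCM ReM /= mulrN opprK mulrDr.
  by rewrite !mulrA.
exact: cvgD la lb.
Qed.

End pairing_limits.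

Lemma energy_identity : weak_solution D p V E u g ->
  mu.-integrable D (EFin \o (fun x => (V x + E) * U x `^ p)) /\
  \int[mu]_(x in D) (A x `^ p) = \int[mu]_(x in D) ((V x + E) * U x `^ p).
Proof.
move=> ws; have [phi [Cphi cR cI]] := W01p_limits mD p1 W.
have lim1 := gradient_pairing_limit Cphi cR cI.
have [iV lim2] := potential_pairing_limit Cphi cR cI; split => //.
apply: (cvg_unique _ lim1); first exact: norm_hausdorff.
apply: cvg_trans lim2; apply: near_eq_cvg; apply: nearW => k.
by rewrite (ws _ (Cc_infty_conj (Cphi k))).
Qed.

End energy_identity.


(** * The lower bound for the Sobolev constant *)

Section lower_bound.
Context {R : realType}.
Local Open Scope ereal_scope.

Lemma integral_abs_powR_eq0 n (D : set 'rV[R]_n) (f : 'rV[R]_n -> R) (s : R) :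
  measurable D -> measurable_fun D f ->
  \int[lebesgue_rV n]_(x in D) (`|f x| `^ s)%:E = 0 ->
  {ae lebesgue_rV n, forall x, D x -> f x = 0%R}.
Proof.
move=> mD mf f0.
have [h _] := @ae_eq_integral_abs _ _ _ (@lebesgue_rV R n) D mD _
  (measurable_abs_powR s mf).
have {}h := h _; rewrite (eq_integral (fun x => (`|f x| `^ s)%:E)) in h; last first.
  by move=> x _; rewrite gee0_abs.
apply: filterS (h f0) => x /= fx Dx; have [] := fx Dx.
by move=> /eqP; rewrite powR_eq0 normr_eq0 => /andP[/eqP].
Qed.

Lemma sobolev_lower_bound (m : nat) (D : set 'rV[R]_m.+2) (p q : R)
    (r : \bar R) (V : 'rV[R]_m.+2 -> R) (E : R)
    (u : 'rV[R]_m.+2 -> R[i]) (Du : 'rV[R]_m.+2 -> 'rV[R[i]]_m.+2) :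
  open D -> bounded_set D -> (1 < p)%R -> (p < m.+2%:R)%R ->
  (m.+2%:R / p)%:E < r -> r^-1 + (p / q)%:E = 1 -> in_Lp D r V ->
  W01p D p u Du -> nontrivial_on D u -> weak_solution D p V E u Du ->
  1 <= sobolev_constant D q p `^ p
       * Lnorm_on D r (fun x => Num.max (V x + E) 0)%R.
Proof.
move=> oD bD p1 pm nr rq VL W nt ws; have p0 : (0 < p)%R by exact: lt_trans p1.
have mD := open_measurable_rV oD.
have [r1 q0 pqP] := exponent_range p1 pm nr rq.
have r0 : 0 < r by exact: lt_le_trans r1.
have [[muR uRp] [muI uIp] gR gI] := W01p_components mD p0 W.
have mU := measurable_W01p_modulus mD p1 W.
have mA := measurable_W01p_gradient mD p1 W.
have bfin := W01p_modulus_lty mD bD p1 pm q0 pqP W.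
have afin := W01p_gradient_lty mD p1 W.
have [iV energy] := energy_identity mD bD p1 pm r1 rq q0 pqP VL W ws.
set a := \int[_]_(x in D) _ in afin; set b := \int[_]_(x in D) _ in bfin.
have a0 : 0 <= a by exact: integral_ge0.
have b0 : 0 <= b by exact: integral_ge0.
have afn : a \is a fin_num by rewrite (ge0_fin_numE a0); exact: afin.
have aE : a = (fine a)%:E by rewrite (fineK afn).
(* If a = 0, all real components of Du have zero L^p norm, and [C1_limit_eq0] forces both parts of u
   to vanish almost everywhere on D. *)
have a_gt0 : (0 < fine a)%R.
  rewrite lt_neqAle (fine_ge0 a0) andbT eq_sym.
  apply: contra_notN nt => /eqP fa0.
  have {fa0}a_eq0 : a = 0 by rewrite aE fa0.
  have comp0 (h : 'rV[R]_m.+2 -> R) : measurable_fun D h ->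
      (forall x, `|h x| <= vec_modulus (Du x))%R ->
      \int[lebesgue_rV m.+2]_(x in D) (`|h x| `^ p)%:E = 0.
    move=> mh hA; apply/eqP; rewrite eq_le integral_ge0//= andbT.
    rewrite -[leRHS]a_eq0; apply: ge0_le_integral => //.
    - exact: measurable_abs_powR.
    - exact: measurable_abs_powR.
    move=> x _; rewrite lee_fin ge0_ler_powR ?nnegrE ?(ltW p0)//.
    exact: le_trans (hA x) (ler_norm _).
  have [phi [_ cR cI]] := W01p_limits mD p1 W.
  have uR0 := C1_limit_eq0 p1 pm mD bD muR (fun i => (gR i).1) cR
    (fun i => comp0 _ (gR i).1
      (fun x => le_trans (normr_Re_le _) (modulus_le_vec _ _))).
  have uI0 := C1_limit_eq0 p1 pm mD bD muI (fun i => (gI i).1) cI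
    (fun i => comp0 _ (gI i).1
      (fun x => le_trans (normr_Im_le _) (modulus_le_vec _ _))).
  apply: filterS2 (integral_abs_powR_eq0 mD muR uR0)
    (integral_abs_powR_eq0 mD muI uI0) => x uRx uIx Dx.
  by move: (uRx Dx) (uIx Dx); case: (u x) => c e /= -> ->.
set N := Lnorm_on D r _; have N0 : 0 <= N by exact: Lnorm_ge0.
have mV : measurable_fun D V by exact: (measurable_restrictT V mD).2 VL.1.
have aN : a <= N * b `^ (p / q).
  have -> : a = (\int[lebesgue_rV m.+2]_(x in D) (vec_modulus (Du x) `^ p))%R%:E.
    rewrite aE /Rintegral; congr (fine _)%:E; apply: eq_integral => x _.
    by rewrite ger0_norm// vec_modulus_ge0.
  rewrite energy /Rintegral fineK; last exact: integrable_fin_num iV.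
  pose f x := ((V x + E) * modulus (u x) `^ p)%:E.
  change (\int[lebesgue_rV m.+2]_(x in D) f x <= N * b `^ (p / q)).
  (* Dropping the negative part of the integrand replaces V + E by its positive part, as |u|^p >=
     0. *)
  rewrite integralE.
  apply: (@le_trans _ _ (\int[lebesgue_rV m.+2]_(x in D) f^\+ x)).
    by rewrite -[leRHS]sube0; apply: leeB => //; exact: integral_ge0.
  (* |u|^p is measured in L^(q/p), the exponent conjugate to r; its norm there is b^(p/q), the p-th
     power of the L^q norm of u. *)
  have s0 : (0 < q / p)%R by exact: divr_gt0.
  have rs : r^-1 + ((q / p)^-1)%:E = 1 by rewrite invf_div.
  have mM : measurable_fun D (fun x => Num.max (V x + E) 0)%R.
    by apply: measurable_maxr => //; exact: measurable_funD.
  have mUp : measurable_fun D (fun x => modulus (u x) `^ p)%R.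
    by apply: (measurableT_comp (measurable_powR _)).
  have := le_Lnorm_on_poweR mD mM mUp r0 s0 rs.
  rewrite invf_div -/N => le_N; apply: le_trans (_ : _ <= N *
    (\int[lebesgue_rV m.+2]_(x in D) (`|modulus (u x) `^ p| `^ (q / p))%:E)
      `^ (p / q)) _.
    apply: le_trans le_N; rewrite le_eqVlt; apply/orP; left; apply/eqP.
    apply: eq_integral => x _; rewrite funeposE /f -EFin_max; congr EFin.
    rewrite ger0_norm; last by rewrite mulr_ge0 ?powR_ge0// le_max lexx orbT.
    by rewrite maxr_pMl ?powR_ge0// mul0r.
  suff -> : \int[lebesgue_rV m.+2]_(x in D)
      (`|modulus (u x) `^ p| `^ (q / p))%:E = b by exact: lexx.
  apply: eq_integral => x _; rewrite (ger0_norm (powR_ge0 _ _)) -powRrM.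
  by rewrite mulrCA mulfV ?gt_eqF// mulr1 ger0_norm// modulus_ge0.
have KE : (b `^ q^-1 * ((fine a `^ p^-1)^-1)%:E) <= sobolev_constant D q p.
  apply: ereal_sup_ubound; exists u, Du; split => //.
  rewrite !Lnorm_onE ?gt_eqF//; congr (_ * _).
  rewrite -/a aE poweR_EFin inver gt_eqF//; exact: powR_gt0.
have a'0 : 0 <= ((fine a `^ p^-1)^-1)%:E by rewrite lee_fin invr_ge0 powR_ge0.
have Kp : b `^ (p / q) * ((fine a)^-1)%:E <= sobolev_constant D q p `^ p.
  apply: le_trans (ge0_le_poweR (ltW p0) (mule_ge0 (poweR_ge0 _ _) a'0) KE).
  rewrite poweRM ?poweR_ge0// -poweRrM [(q^-1 * p)%R]mulrC poweR_EFin.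
  rewrite -powRN -powRrM mulNr mulVf ?gt_eqF// powR_inv1//.
  exact: ltW.
(* 1 = a / a <= N b^(p/q) / a, where b^(p/q) / a is the p-th power of the quotient of norms attached
   to u. *)
apply: (@le_trans _ _ (b `^ (p / q) * ((fine a)^-1)%:E * N)); last exact: lee_wpmul2r.
rewrite muleAC [X in X * _]muleC.
apply: (@le_trans _ _ (a * ((fine a)^-1)%:E)).
  by rewrite [X in X * _]aE -EFinM mulfV ?gt_eqF.
by apply: lee_wpmul2r => //; rewrite lee_fin invr_ge0 ltW.
Qed.

End lower_bound.

Theorem corollary1p2 (R : realType) (n : nat) (D : set 'rV[R]_n)
    (p q : R) (r : \bar R) (V : 'rV[R]_n -> R) (E : R)
    (u : 'rV[R]_n -> R[i]) (Du : 'rV[R]_n -> 'rV[R[i]]_n) :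
  open D -> bounded_set D ->
  1 < p -> p < n%:R ->
  ((n%:R / p)%:E < r)%E ->
  (r^-1 + (p / q)%:E = 1)%E ->
  in_Lp D r V ->
  E <= 0 ->
  W01p D p u Du ->
  nontrivial_on D u ->
  weak_solution D p V E u Du ->
  (1 <= sobolev_constant D q p `^ p
        * Lnorm_on D r (fun x => (Num.max (V x + E) 0)%R))%E.
Proof.
(* 1 < p < n excludes n = 0 and n = 1, hence the dimension m + 2 used throughout. *)
case: n D V u Du => [|[|m]] D V u Du oD bD p1 pn nr rq VL _ W nt ws.
- by have := lt_trans p1 pn; rewrite ltr10.
- by have := lt_trans p1 pn; rewrite ltxx.
exact: (sobolev_lower_bound oD bD p1 pn nr rq VL W nt ws).
Qed.
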